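(* Every non-orientable $3$-dimensional Bieberbach manifold is the geodesic boundary of a compact flat $4$-dimensional Riemannian manifold.
   Context: All manifolds are assumed connected. A Bieberbach group in dimension $m$ is a discrete, co-compact group of affine isometries of $\mathbb{R}^m$ acting without fixed points; a Bieberbach manifold is the quotient $\mathbb{R}^m/\Gamma$ of $\mathbb{R}^m$ by such a group with the induced flat metric. A Bieberbach manifold $N$ of dimension $m$ is the geodesic boundary of a compact flat manifold if there is a compact flat Riemannian manifold $M$ of dimension $m+1$ with totally geodesic boundary $\partial M$ isometric to $N$. *)

(* Defs.v *)
From HB Require Import structures.
From mathcomp Require Import all_boot all_order all_algebra.
From mathcomp Require Import generic_quotient.
From mathcomp Require Import all_classical all_reals all_analysis.

Set Implicit Arguments.
Unset Strict Implicit.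
Unset Printing Implicit Defensive.

Import Order.TTheory GRing.Theory Num.Theory.
Import numFieldNormedType.Exports.

Local Open Scope classical_set_scope.
Local Open Scope ring_scope.
Local Open Scope quotient_scope.

Section Smooth.
Context {R : realType} {V W : normedModType R}.

Fixpoint Ck_on (k : nat) (U : set V) (F : V -> W) : Prop :=
  match k with
  | 0 => forall x, U x -> continuous_at x F
  | k'.+1 => (forall x, U x -> differentiable F x) /\
             (forall v, Ck_on k' U (fun x => 'D_v F x))
  end.

Definition smooth_on (U : set V) (F : V -> W) : Prop :=
  forall k, Ck_on k U F.

End Smooth.

(* A chart carries no inverse map: injectivity of [chart_map] on [chart_dom] is
   required in [is_chart], and the values outside [chart_dom] are irrelevant. *)
Record chart (T : Type) (R : realType) (n : nat) := Chart {
  chart_dom : set T;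
  chart_map :> T -> 'rV[R]_n }.

(* [coord_expr c D h p F]: near [p], the map [h] restricted to [D] reads in the
   chart [c] as [F], where [F] is smooth on a full open neighbourhood of [c p]
   in R^n.  At points of the boundary of a half-space this is the usual notion
   of smoothness (existence of a local smooth extension).  The derivatives of
   [F] at [c p] do not depend on the extension [F] when the image under [c] of
   a neighbourhood of [p] in [D] is open in R^n or in a half-space. *)
Definition coord_expr {T : Type} {R : realType} {n : nat} {V : normedModType R}
    (c : chart T R n) (D : set T) (h : T -> V) (p : T)
    (F : 'rV[R]_n -> V) : Prop :=
  exists O : set 'rV[R]_n, [/\ open O, O (c p), smooth_on O F &
    forall q, chart_dom c q -> D q -> O (c q) -> F (c q) = h q].

Section Charts.
Context {T : topologicalType} {R : realType} {n : nat}.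
Implicit Types c d : chart T R n.+1.

Definition half_space : set 'rV[R]_n.+1 := [set x | 0 <= x 0 ord_max].

Definition full_chart c : Prop := forall U : set T,
  open U -> U `<=` chart_dom c -> open (c @` U).

Definition half_chart c : Prop := forall U : set T,
  open U -> U `<=` chart_dom c ->
  exists2 O : set 'rV[R]_n.+1, open O & c @` U = O `&` half_space.

(* A homeomorphism from an open set of [T] onto an open subset of R^(n+1), or
   onto a relatively open subset of the closed half-space. *)
Definition is_chart c : Prop :=
  [/\ open (chart_dom c),
      forall p q, chart_dom c p -> chart_dom c q -> c p = c q -> p = q,
      forall p, chart_dom c p -> continuous_at p c &
      full_chart c \/ half_chart c].

Definition smooth_transition c d : Prop :=
  forall p, chart_dom c p -> chart_dom d p ->
  exists F, coord_expr c (chart_dom d) d p F.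

End Charts.

(* [gram i p] is the matrix of the metric at [p] in the coordinate frame of the
   chart [atlas i]; it is only relevant when [p] is in the domain of that chart.
   The axioms are in [is_riemannian]. *)
Record riem_data (R : realType) (n : nat) := RiemData {
  points :> topologicalType;
  chart_idx : Type;
  atlas : chart_idx -> chart points R n;
  gram : chart_idx -> points -> 'M[R]_n }.

(* Vectors are rows, so ['J F x] has entry ['D_(e_i) F_j x] in position (i, j)
   and the pullback of a Gram matrix [g] is [J *m g *m J^T]. *)
Definition pullback {R : realType} {n m : nat} (F : 'rV[R]_n -> 'rV[R]_m)
    (x : 'rV[R]_n) (g : 'M[R]_m) : 'M[R]_n := 'J F x *m g *m ('J F x)^T.

(* Connected smooth Riemannian manifold of dimension n.+1, possibly with
   boundary. *)
Record is_riemannian {R : realType} {n : nat} (M : riem_data R n.+1) : Prop := {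
  riem_hausdorff : hausdorff_space M;
  riem_second_countable : @second_countable (points M);
  riem_connected : connected [set: M];
  riem_cover : forall p : M, exists i : chart_idx M, chart_dom (atlas i) p;
  riem_chart : forall i : chart_idx M, is_chart (atlas i);
  riem_transition : forall i j : chart_idx M,
    smooth_transition (atlas i) (atlas j);
  riem_metric_smooth : forall (i : chart_idx M) (p : M),
    chart_dom (atlas i) p ->
    exists G, coord_expr (atlas i) setT (gram i) p G;
  riem_metric_sym : forall (i : chart_idx M) (p : M), chart_dom (atlas i) p ->
    (gram i p)^T = gram i p;
  riem_metric_pos : forall (i : chart_idx M) (p : M), chart_dom (atlas i) p ->
    forall v : 'rV[R]_n.+1, v != 0 -> 0 < (v *m gram i p *m v^T) 0 0;
  riem_metric_tensor : forall (i j : chart_idx M) (p : M),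
    chart_dom (atlas i) p -> chart_dom (atlas j) p ->
    exists2 F, coord_expr (atlas i) (chart_dom (atlas j)) (atlas j) p F &
      gram i p = pullback F (atlas i p) (gram j p) }.

Section LocalGeometry.
Context {R : realType} {n : nat} (G : 'rV[R]_n -> 'M[R]_n).

Definition partial (i : 'I_n) (h : 'rV[R]_n -> R) (x : 'rV[R]_n) : R :=
  'D_(delta_mx 0 i : 'rV[R]_n) h x.

(* Gamma^k_(ij) *)
Definition christoffel (k i j : 'I_n) (x : 'rV[R]_n) : R :=
  2^-1 * \sum_(l < n) invmx (G x) k l *
    (partial i (fun y => G y j l) x + partial j (fun y => G y i l) x
     - partial l (fun y => G y i j) x).

(* R^l_(kij), i.e. R(e_i, e_j) e_k = \sum_l R^l_(kij) e_l *)
Definition riemann_curvature (l k i j : 'I_n) (x : 'rV[R]_n) : R :=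
  partial i (christoffel l j k) x - partial j (christoffel l i k) x
  + \sum_(m < n) (christoffel l i m x * christoffel m j k x
                  - christoffel l j m x * christoffel m i k x).

End LocalGeometry.

(* In a chart with values in the half-space {x_n >= 0}, the inward unit normal
   to the boundary is nu = \sum_k G^(nk) e_k / sqrt (G^(nn)), so that
   <e_k, nu> = 0 for k <> n and <e_n, nu> = 1 / sqrt (G^(nn)).  Hence
   II(e_a, e_b) = <nabla_(e_a) e_b, nu> = Gamma^n_(ab) / sqrt (G^(nn)). *)
Definition second_fundamental_form {R : realType} {n : nat}
    (G : 'rV[R]_n.+1 -> 'M[R]_n.+1) (a b : 'I_n) (x : 'rV[R]_n.+1) : R :=
  christoffel G ord_max (lift ord_max a) (lift ord_max b) x
  / Num.sqrt (invmx (G x) ord_max ord_max).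

Section Manifolds.
Context {R : realType} {n : nat}.
Implicit Types M : riem_data R n.+1.

Definition boundary_chart_at M (i : chart_idx M) (p : M) : Prop :=
  [/\ half_chart (atlas i), chart_dom (atlas i) p & (atlas i p) 0 ord_max = 0].

Definition boundary_points M : set M :=
  [set p | exists i, boundary_chart_at i p].
Arguments boundary_points M _ : clear implicits.

Definition flat M : Prop :=
  forall (i : chart_idx M) (p : M), chart_dom (atlas i) p ->
  exists2 G, coord_expr (atlas i) setT (gram i) p G &
    forall l k a b, riemann_curvature G l k a b (atlas i p) = 0.

Definition totally_geodesic_boundary M : Prop :=
  forall (i : chart_idx M) (p : M), boundary_chart_at i p ->
  exists2 G, coord_expr (atlas i) setT (gram i) p G &
    forall a b, second_fundamental_form G a b (atlas i p) = 0.

(* The boundary with the induced metric: the charts are the half-space charts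
   with the last coordinate (zero on the boundary) dropped. *)
Definition boundary M : riem_data R n :=
  @RiemData R n (set_type (boundary_points M)) (chart_idx M)
    (fun i => Chart
      [set p | half_chart (atlas i) /\ chart_dom (atlas i) (set_val p)]
      (fun p => col' ord_max (atlas i (set_val p))))
    (fun i p => row' ord_max (col' ord_max (gram i (set_val p)))).

Definition orientable M : Prop :=
  exists A : set (chart M R n.+1),
  [/\ forall p : M, exists2 c, A c & chart_dom c p,
      forall c, A c -> is_chart c,
      forall c i, A c ->
        smooth_transition c (atlas i) /\ smooth_transition (atlas i) c &
      forall c d p, A c -> A d -> chart_dom c p -> chart_dom d p ->
        exists2 F, coord_expr c (chart_dom d) d p F & 0 < \det ('J F (c p))].

End Manifolds.

Definition smooth_map {R : realType} {n m : nat}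
    (M : riem_data R n) (N : riem_data R m) (f : M -> N) : Prop :=
  continuous f /\
  forall (i : chart_idx M) (j : chart_idx N) (p : M),
    chart_dom (atlas i) p -> chart_dom (atlas j) (f p) ->
    exists F, coord_expr (atlas i) (f @^-1` chart_dom (atlas j))
                (fun q => atlas j (f q)) p F.

Definition preserves_metric {R : realType} {n m : nat}
    (M : riem_data R n) (N : riem_data R m) (f : M -> N) : Prop :=
  forall (i : chart_idx M) (j : chart_idx N) (p : M),
    chart_dom (atlas i) p -> chart_dom (atlas j) (f p) ->
    exists2 F, coord_expr (atlas i) (f @^-1` chart_dom (atlas j))
                 (fun q => atlas j (f q)) p F &
      gram i p = pullback F (atlas i p) (gram j (f p)).

Definition isometric {R : realType} {n : nat} (M N : riem_data R n) : Prop :=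
  exists (f : M -> N) (g : N -> M),
    [/\ cancel f g, cancel g f, smooth_map f, smooth_map g
      & preserves_metric f].

Section AffineIsometries.
Context {R : realType} {m : nat}.

(* The affine map x |-> x A + b is represented by the pair (A, b). *)
Definition affine_map : Type := ('M[R]_m * 'rV[R]_m)%type.

Definition aff_act (g : affine_map) (x : 'rV[R]_m) : 'rV[R]_m :=
  x *m g.1 + g.2.

Definition aff_id : affine_map := (1%:M, 0).

(* first g, then h *)
Definition aff_comp (g h : affine_map) : affine_map :=
  (g.1 *m h.1, g.2 *m h.1 + h.2).

Definition is_affine_isometry (g : affine_map) : Prop := g.1 *m g.1^T = 1%:M.

Variable Gamma : set ('M[R]_m * 'rV[R]_m).

Definition orbit_of (x : 'rV[R]_m) : set 'rV[R]_m :=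
  [set aff_act g x | g in Gamma].

Definition same_orbit : rel 'rV[R]_m :=
  fun x y => `[< orbit_of x = orbit_of y >].

Lemma same_orbit_equiv : equiv_class_of same_orbit.
Proof.
split=> [x|x y|y x z].
- exact/asboolP.
- by apply/asboolP/asboolP.
- by move=> /asboolP xy /asboolP yz; apply/asboolP; rewrite xy.
Qed.

Definition same_orbit_rel : equiv_rel 'rV[R]_m :=
  EquivRelPack same_orbit_equiv.

Definition orbit_space : topologicalType :=
  quotient_topology {eq_quot same_orbit_rel}.

Definition orbit_proj (x : 'rV[R]_m) : orbit_space :=
  \pi_(quotient_topology {eq_quot same_orbit_rel}) x.

(* The smooth structure and flat metric induced on R^m / Gamma: the charts are
   the local inverses of the projection, in which the metric is Euclidean. *)
Definition flat_quotient : riem_data R m :=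
  @RiemData R m orbit_space
    {U : set 'rV[R]_m | open U /\
       forall x y, U x -> U y -> orbit_proj x = orbit_proj y -> x = y}
    (fun U => Chart (orbit_proj @` sval U)
       (fun q => xget 0 [set x | sval U x /\ orbit_proj x = q]))
    (fun _ _ => 1%:M).

(* Discreteness is with respect to the topology of 'M[R]_m * 'rV[R]_m, which
   induces the usual one on the group of affine isometries. *)
Record bieberbach_group : Prop := {
  bieb_isometry : forall g, Gamma g -> is_affine_isometry g;
  bieb_id : Gamma aff_id;
  bieb_comp : forall g h, Gamma g -> Gamma h -> Gamma (aff_comp g h);
  bieb_inv : forall g, Gamma g -> exists2 h, Gamma h & aff_comp g h = aff_id;
  bieb_discrete : forall g, Gamma g -> isolated Gamma g;
  bieb_cocompact : compact [set: orbit_space];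
  bieb_free : forall g x, Gamma g -> aff_act g x = x -> g = aff_id }.

End AffineIsometries.

Definition geodesic_boundary_of_compact_flat {R : realType} {m : nat}
    (N : riem_data R m) : Prop :=
  exists M : riem_data R m.+1,
    [/\ is_riemannian M /\ compact [set: M], flat M,
        totally_geodesic_boundary M & isometric (boundary M) N].

(* Main.v *)
(* If Gamma has index two in a group Delta acting freely and discretely on R^m,
   then Delta acts on R^m x [0, 2] with the elements outside Gamma flipping the
   interval.  The quotient is a compact flat twisted interval bundle, whose
   totally geodesic boundary is R^m / Gamma.  It remains to find Delta.

   An orientation-reversing element of Gamma (m = 3) has no fixed point, so its
   linear part has eigenvalue 1 and is a reflection.  For two such elements
   with linear parts r_n and r_k the commutator has linear part (r_n r_k)^2, a
   rotation about the common axis, and no translation along that axis; having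
   no fixed point unless trivial, it forces r_n and r_k to commute.  Hence the
   holonomy is {1, r_n} or {1, r_n, r_k, r_n r_k} with n and k orthogonal.
   In the second case the linear parts r_n and r_k do not both occur without
   translation along the common axis (their product would be a rotation with
   a fixed point), so one may assume that r_k does not.  Cocompactness gives
   translations in Gamma along n; let v be one half of such a translation with
   v not in Gamma.  Then Delta is generated by Gamma and the translation by v:
   it normalizes Gamma because n is an eigenvector of the holonomy, and the new
   elements have no fixed points: those with n -> -n are conjugate to elements
   of Gamma by the translation by v / 2, and for those with n -> n the
   translation by v is orthogonal to the axis along which they move. *)
Require Import Defs.
From mathcomp Require Import all_boot all_order all_algebra.
From mathcomp Require Import generic_quotient.
From mathcomp Require Import all_classical all_reals all_analysis.
From mathcomp Require finmap.
From mathcomp Require Import ring lra.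

Set Implicit Arguments.
Unset Strict Implicit.
Unset Printing Implicit Defensive.

Import Order.TTheory GRing.Theory Num.Theory.
Import numFieldNormedType.Exports.

Local Open Scope classical_set_scope.
Local Open Scope ring_scope.

(** * Estimates for the maximum norm of matrices *)

Section MatrixNorm.
Context {R : realType}.

Lemma mx_norm_leP {m n} (x : 'M[R]_(m, n)) (e : R) :
  0 <= e -> reflect (forall i j, `|x i j| <= e) (`|x| <= e).
Proof.
move=> e0; rewrite [`|x|]mx_normrE; apply: (iffP idP) => [|xe].
  by move=> /bigmax_leP[_ xe] i j; exact: (xe (i, j)).
by apply/bigmax_leP; split.
Qed.

Lemma mx_norm_coord {m n} (x : 'M[R]_(m, n)) i j : `|x i j| <= `|x|.
Proof. by move: i j; apply/mx_norm_leP. Qed.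

(** The norm is the largest absolute value of an entry, and an entry of the product is a sum of [n]
    terms. This factor reappears in the Lipschitz constant of affine isometries. *)
Lemma mx_norm_mul {m n p} (x : 'M[R]_(m, n)) (A : 'M[R]_(n, p)) :
  `|x *m A| <= n%:R * (`|x| * `|A|).
Proof.
apply/mx_norm_leP => [|i j]; first by rewrite !mulr_ge0.
rewrite mxE (le_trans (ler_norm_sum _ _ _))//.
rewrite (_ : n%:R * _ = \sum_(k < n) `|x| * `|A|); last first.
  by rewrite sumr_const card_ord mulr_natl.
by apply: ler_sum => k _; rewrite normrM ler_pM// mx_norm_coord.
Qed.

Lemma mx_norm_tr {m n} (A : 'M[R]_(m, n)) : `|A^T| = `|A|.
Proof.
have trle k l (B : 'M[R]_(k, l)) : `|B^T| <= `|B|.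
  by apply/mx_norm_leP => // i j; rewrite mxE mx_norm_coord.
by apply/le_anti; rewrite trle /= -{1}[A]trmxK trle.
Qed.

(** The rows of an orthogonal matrix are Euclidean unit vectors, so no entry exceeds 1 in absolute
    value. *)
Lemma mx_norm_isometry {m} (A : 'M[R]_m) : A *m A^T = 1%:M -> `|A| <= 1.
Proof.
move=> AA; apply/mx_norm_leP => // i j; move: AA.
move=> /matrixP/(_ i i).
rewrite !mxE eqxx mulr1n => s1.
rewrite -(@ler_pXn2r _ 2)// ?nnegrE// expr1n -normrX.
rewrite ger0_norm ?sqr_ge0// -[leRHS]s1 (bigD1 j)//= mxE -expr2 lerDl.
by apply: sumr_ge0 => k _; rewrite mxE -expr2 sqr_ge0.
Qed.

End MatrixNorm.

(** * The algebra of affine isometries *)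

Section AffineMaps.
Context {R : realType} {m : nat}.
Implicit Types (g h k : @affine_map R m) (x y : 'rV[R]_m).

(** The transpose stands in for the inverse matrix, so this inverts [g] only when its linear part is
    orthogonal. *)
Definition aff_inv g : @affine_map R m := (g.1^T, - (g.2 *m g.1^T)).

Lemma aff_act_id x : aff_act aff_id x = x.
Proof. by rewrite /aff_act mulmx1 addr0. Qed.

Lemma aff_act_comp g h x : aff_act (aff_comp g h) x = aff_act h (aff_act g x).
Proof. by rewrite /aff_act /= mulmxDl mulmxA addrA. Qed.

Lemma aff_compA g h k : aff_comp g (aff_comp h k) = aff_comp (aff_comp g h) k.
Proof. by rewrite /aff_comp /= mulmxA mulmxDl addrA mulmxA. Qed.

Lemma aff_comp1 g : aff_comp g aff_id = g.
Proof. by case: g => A b; rewrite /aff_comp /= !mulmx1 addr0. Qed.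

Lemma aff_comp_id g : aff_comp aff_id g = g.
Proof. by case: g => A b; rewrite /aff_comp /= !mul1mx mul0mx add0r. Qed.

Lemma aff_isometryC g : is_affine_isometry g -> g.1^T *m g.1 = 1%:M.
Proof. by move=> /mulmx1C. Qed.

Lemma aff_compV g : is_affine_isometry g -> aff_comp g (aff_inv g) = aff_id.
Proof. by move=> gi; rewrite /aff_comp /= gi subrr. Qed.

Lemma aff_compVg g : is_affine_isometry g -> aff_comp (aff_inv g) g = aff_id.
Proof.
move=> gi; rewrite /aff_comp /= aff_isometryC// mulNmx -mulmxA.
by rewrite aff_isometryC// mulmx1 addNr.
Qed.

Lemma aff_actK g x : is_affine_isometry g ->
  aff_act (aff_inv g) (aff_act g x) = x.
Proof. by move=> gi; rewrite -aff_act_comp aff_compV// aff_act_id. Qed.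

Lemma aff_comp_inv_uniq g h : is_affine_isometry g ->
  aff_comp g h = aff_id -> h = aff_inv g.
Proof.
by move=> gi e; rewrite -[h]aff_comp_id -(aff_compVg gi) -aff_compA e aff_comp1.
Qed.

Lemma aff_act_lipschitz g x y : is_affine_isometry g ->
  `|aff_act g x - aff_act g y| <= m%:R * `|x - y|.
Proof.
move=> gi; rewrite /aff_act opprD addrACA subrr addr0 -mulmxBl.
apply: le_trans (mx_norm_mul _ _) _.
by rewrite ler_wpM2l// ler_piMr// mx_norm_isometry.
Qed.

End AffineMaps.

(** * Smoothness and Jacobians of affine maps *)

Section Smoothness.
Context {R : realType}.

Lemma mulmxr_continuous {m n} (A : 'M[R]_(m, n)) :
  continuous (fun x : 'rV[R]_m => x *m A).
Proof.
move=> x; have fx : Filter (nbhs x) by exact: nbhs_filter.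
apply/(@cvgrPdist_lt R 'rV[R]_n 'rV[R]_m (nbhs x) fx) => e e0.
have d0 : 0 < m%:R * `|A| + 1 :> R by rewrite ltr_wpDl// mulr_ge0.
apply/nbhs_ballP; exists (e / (m%:R * `|A| + 1)) => /=; first exact: divr_gt0.
move=> y; rewrite -ball_normE /= ltr_pdivlMr// => xy.
rewrite -mulmxBl (le_lt_trans (mx_norm_mul _ _))//; apply: le_lt_trans xy.
by rewrite mulrCA ler_wpM2l// lerDl.
Qed.

Lemma Ck_on_cst {V W : normedModType R} k (U : set V) (w : W) :
  Ck_on k U (fun=> w).
Proof.
elim: k w => [w x _|k IH w]; first exact: cvg_cst.
split=> [x _|v]; first exact: differentiable_cst.
have -> : (fun x : V => 'D_v (fun=> w) x) = (fun=> 0 : W).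
  by apply/funext => x; rewrite derive_cst.
exact: IH.
Qed.

Lemma smooth_on_cst {V W : normedModType R} (U : set V) (w : W) :
  smooth_on U (fun=> w).
Proof. by move=> k; exact: Ck_on_cst. Qed.

Lemma aff_act_is_diff {m n} (A : 'M[R]_(m, n)) b (x : 'rV[R]_m) :
  is_diff x (fun x => x *m A + b) (mulmxr A).
Proof.
have L : is_diff x (mulmxr A : 'rV[R]_m -> 'rV[R]_n) (mulmxr A).
  apply: DiffDef; first exact/linear_differentiable/mulmxr_continuous.
  by rewrite diff_lin//; exact: mulmxr_continuous.
have := @is_diffD _ _ _ _ (cst b) _ _ x L (is_diff_cst b x).
by rewrite addr0.
Qed.

(** After one differentiation every directional derivative is constant, which leaves [Ck_on_cst]. *)
Lemma affine_smooth {m n} (A : 'M[R]_(m, n)) b (U : set 'rV[R]_m) :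
  smooth_on U (fun x => x *m A + b).
Proof.
case=> [|k].
  by move=> x _; apply/differentiable_continuous;
    have [] := aff_act_is_diff A b x.
split=> [x _|v]; first by have [] := aff_act_is_diff A b x.
rewrite (_ : (fun x => _) = fun=> v *m A); first exact: Ck_on_cst.
apply/funext => x; have dx := aff_act_is_diff A b x.
rewrite deriveE; last by case: dx.
by rewrite (_ : 'd _ _ = mulmxr A :> (_ -> _))//; exact: diff_val.
Qed.

Lemma jacobian_affine {m n} (A : 'M[R]_(m, n)) b (x : 'rV[R]_m) :
  'J (fun x => x *m A + b) x = A.
Proof.
apply/row_matrixP => i; rewrite rowE.
rewrite -deriveEjacobian; last by have [] := aff_act_is_diff A b x.
have dx := aff_act_is_diff A b x.
rewrite deriveE; last by case: dx.
by rewrite (_ : 'd _ _ = mulmxr A :> (_ -> _)) /= ?rowE//; exact: diff_val.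
Qed.

End Smoothness.

(** * Free discrete groups of isometries and their orbits *)

Section DiscreteGroups.
Context {R : realType} {m : nat}.
Implicit Types (Gamma : set (@affine_map R m)) (g h : @affine_map R m).
Implicit Types x y : 'rV[R]_m.

(** Cocompactness is not part of this notion because it has to cover the suspended group on R^(m+1),
    whose quotient is unbounded in the last coordinate. Discreteness is stated at the identity only,
    as an explicit radius. *)
Record free_discrete_group Gamma : Prop := {
  fdg_isometry : forall g, Gamma g -> is_affine_isometry g;
  fdg_id : Gamma aff_id;
  fdg_comp : forall g h, Gamma g -> Gamma h -> Gamma (aff_comp g h);
  fdg_inv : forall g, Gamma g -> Gamma (aff_inv g);
  fdg_discrete : exists2 e : R, 0 < e & forall g, Gamma g ->
    `|g.1 - 1%:M| < e -> `|g.2| < e -> g = aff_id;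
  fdg_free : forall g x, Gamma g -> aff_act g x = x -> g = aff_id }.

Lemma bieberbach_free_discrete Gamma :
  bieberbach_group Gamma -> free_discrete_group Gamma.
Proof.
case=> iso one mul inv dis _ free; split=> //.
  move=> g Gg; have [h Gh gh] := inv g Gg.
  by rewrite -(aff_comp_inv_uniq (iso _ Gg) gh).
have [_ [V [[P Q] [/= nP nQ] PQV] VG]] := dis _ one.
have [e /= e0 eP] := (iffLR (nbhs_ballP (1%:M : 'M[R]_m) P)) nP.
have [d /= d0 dQ] := (iffLR (nbhs_ballP (0 : 'rV[R]_m) Q)) nQ.
exists (Num.min e d) => [|g Gg]; first by rewrite lt_min e0.
rewrite !lt_min => /andP[ge _] /andP[_ gd].
suff : (V `&` Gamma) g by rewrite VG.
split=> //; apply: PQV; split.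
  by apply: eP; rewrite -ball_normE /= distrC.
by apply: dQ; rewrite -ball_normE /= sub0r normrN.
Qed.

Section Theory.
Context (Gamma : set (@affine_map R m)) (HG : free_discrete_group Gamma).
Let iso := fdg_isometry HG.

(** Discreteness at the identity is applied to [g] followed by the inverse of [h]. Multiplication by
    [h.1^T] enlarges norms by at most [m], whence the division by [m.+1]. *)
Lemma fdg_separated : exists2 e : R, 0 < e & forall g h, Gamma g -> Gamma h ->
  `|g.1 - h.1| < e -> `|g.2 - h.2| < e -> g = h.
Proof.
have [e e0 He] := fdg_discrete HG.
have m0 : 0 < (m.+1)%:R :> R by rewrite ltr0n.
exists (e / m.+1%:R) => [|g h Gg Gh d1 d2]; first by rewrite divr_gt0.
have bd k (z : 'M[R]_(k, m)) : `|z| < e / m.+1%:R -> `|z *m h.1^T| < e.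
  rewrite ltr_pdivlMr// => ze; apply: le_lt_trans (mx_norm_mul _ _) _.
  apply: le_lt_trans ze; rewrite mulrCA ler_wpM2l// mx_norm_tr.
  rewrite -[leRHS]mulr1 ler_pM// ?ler_nat//.
  exact: mx_norm_isometry (iso Gh).
suff gh : aff_comp g (aff_inv h) = aff_id.
  by rewrite -[g]aff_comp1 -(aff_compVg (iso Gh)) aff_compA gh aff_comp_id.
apply: He; first by apply: fdg_comp => //; exact: fdg_inv.
  by rewrite /= -(iso Gh) -mulmxBl bd.
by rewrite /= -mulmxBl bd.
Qed.

(* A cluster point of the [g] moving [x] close to [y] exists because the
   orthogonal group is compact, and is isolated by uniform discreteness. *)
Lemma orbit_closed (S : set (@affine_map R m)) x y : S `<=` Gamma ->
  (forall e : R, 0 < e -> exists2 g, S g & `|aff_act g x - y| < e) ->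
  exists2 g, S g & aff_act g x = y.
Proof.
move=> SG near_y.
(* Pairs are flattened to row vectors, where closed bounded sets are compact. *)
pose iota g : 'rV[R]_(m * m + m) := row_mx (mxvec g.1) g.2.
pose B (e : R) := iota @` [set g | S g /\ `|aff_act g x - y| < e].
pose F := filter_from [set e : R | 0 < e] B.
have FF : ProperFilter F.
  apply: filter_from_proper; last first.
    by move=> e e0; have [g Sg ge] := near_y e e0; exists (iota g); exists g.
  apply: filter_from_filter; first by exists 1 => /=.
  move=> a b /= a0 b0; exists (Num.min a b) => /=; first by rewrite lt_min a0.
  by move=> _ [g [Sg +] <-]; rewrite lt_min => /andP[ga gb]; split; exists g.
(* Linear parts have norm at most 1. The translation part is [(g x - y) + y - x *m g.1], of norm at
   most [1 + |y| + m |x|] once [g x] is within 1 of [y]. *)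
pose C : R := 1 + `|y| + m%:R * `|x| + 1.
have C1 : 1 <= C by rewrite /C; have := mulr_ge0 (ler0n R m) (normr_ge0 x);
  have := normr_ge0 y; lra.
pose K := [set v : 'rV[R]_(m * m + m) | `|v| <= C].
have cK : compact K.
  apply: bounded_closed_compact.
    by exists C; split => [|z Cz v /= vC];
      [exact: num_real|exact: le_trans vC (ltW Cz)].
  apply: (@closed_comp _ _ (fun v : 'rV[R]_(m * m + m) => `|v|) [set z : R | z
    <= C]).
    by move=> v _; exact: norm_continuous.
  exact: closed_le.
have FK : F K.
  exists 1 => //= _ [g [Sg g1] <-]; apply/mx_norm_leP => [|i j]; first lra.
  rewrite mxE; case: splitP => k _.
    have [[a b] ->] : exists ab, k = mxvec_index ab.1 ab.2.
      by case/mxvec_indexP: k => a b; exists (a, b).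
    rewrite ord1 mxvecE (le_trans (mx_norm_coord _ _ _))// (le_trans _ C1)//.
    by apply: mx_norm_isometry; exact: iso (SG _ Sg).
  rewrite ord1 (le_trans (mx_norm_coord _ _ _))//.
  have -> : g.2 = aff_act g x - y + y - x *m g.1.
    by rewrite /aff_act subrK addrC addKr.
  have := mx_norm_mul x g.1; have := mx_norm_isometry (iso (SG _ Sg)).
  have := ler_normB (aff_act g x - y + y) (x *m g.1).
  have := ler_normD (aff_act g x - y) y.
  have : m%:R * (`|x| * `|g.1|) <= m%:R * `|x|.
    by rewrite ler_wpM2l// ler_piMr// mx_norm_isometry//; exact: iso (SG _ Sg).
  by rewrite /C; lra.
have [c [_ Fc]] := cK F FF FK.
have [e e0 sep] := fdg_separated.
pose U : set 'rV[R]_(m * m + m) := ball c (e / 2).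
have nU : nbhs c U by apply: nbhsx_ballx; rewrite divr_gt0.
have uniqU g h : Gamma g -> Gamma h -> U (iota g) -> U (iota h) -> g = h.
  move=> Gg Gh Ug Uh.
  have gh : `|iota g - iota h| < e.
    have : ball (iota g) (e / 2 + e / 2) (iota h) by
      apply: (@ball_triangle _ _ c) => //; exact: ball_sym.
    by rewrite -splitr -ball_normE.
  have gh' : `|row_mx (mxvec (g.1 - h.1)) (g.2 - h.2)| < e.
    by rewrite linearB /= -add_row_mx -opp_row_mx.
  apply: sep => //; apply: le_lt_trans gh'; apply/mx_norm_leP => // i j.
    have := mx_norm_coord (row_mx (mxvec (g.1 - h.1)) (g.2 - h.2)) 0
      (lshift m (mxvec_index i j)).
    by rewrite row_mxEl mxvecE.
  have := mx_norm_coord (row_mx (mxvec (g.1 - h.1)) (g.2 - h.2)) 0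
    (rshift (m * m) j).
  by rewrite row_mxEr ord1.
have inU (d : R) : 0 < d -> exists g, [/\ S g, `|aff_act g x - y| < d & U (iota
  g)].
  move=> d0; have [|_ [[g [Sg gd] <-] Ug]] := Fc (B d) U _ nU;
    first by exists d.
  by exists g.
have [g [Sg _ Ug]] := inU 1 ltr01.
(* If [g x] differed from [y], an element of [S] moving [x] strictly closer to [y] would lie in the
   same small ball, hence be [g] itself. *)
exists g => //; apply/eqP; rewrite -subr_eq0 -normr_eq0.
apply/negP => /negP; rewrite -normr_gt0 normr_id => d0.
have [h [Sh + Uh]] := inU _ d0.
by rewrite (uniqU h g (SG _ Sh) (SG _ Sg) Uh Ug) ltxx.
Qed.

Lemma orbit_separated x y : (forall g, Gamma g -> aff_act g x <> y) ->
  exists2 e : R, 0 < e & forall g, Gamma g -> e <= `|aff_act g x - y|.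
Proof.
move=> xy; apply: contrapT => no.
have [|g Gg gx] := @orbit_closed Gamma x y (@subset_refl _ _);
  last exact: xy gx.
move=> e e0; apply: contrapT => nog; apply: no; exists e => // g Gg.
by rewrite leNgt; apply/negP => ge; apply: nog; exists g.
Qed.

(** [orbit_closed] for [Gamma] without the identity: elements moving [x] arbitrarily little would
    yield a non-trivial element fixing [x]. *)
Lemma orbit_isolated x :
  exists2 e : R, 0 < e & forall g, Gamma g -> `|aff_act g x - x| < e -> g =
    aff_id.
Proof.
apply: contrapT => no.
have [||g [Gg gn] gx] := @orbit_closed (Gamma `\ aff_id) x x.
- by move=> g [].
- move=> e e0; apply: contrapT => nog; apply: no; exists e => // g Gg ge.
  by apply: contrapT => gn; apply: nog; exists g => //; split.
- by apply: gn; exact: (fdg_free HG Gg gx).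
Qed.

End Theory.
End DiscreteGroups.

(** * Topology of the orbit space and local inverses of the projection *)

Section OrbitSpace.
Context {R : realType} {m : nat} (Gamma : set (@affine_map R m)).
Context (HG : free_discrete_group Gamma).
Implicit Types (g h : @affine_map R m) (x y : 'rV[R]_m) (U : set 'rV[R]_m).

Let iso := fdg_isometry HG.
Local Notation p := (orbit_proj Gamma).

Lemma aff_act_continuous g : continuous (aff_act g).
Proof. by move=> x; apply/differentiable_continuous;
  have [] := aff_act_is_diff g.1 g.2 x. Qed.

Lemma orbit_projP x y : p x = p y <-> exists2 g, Gamma g & aff_act g x = y.
Proof.
split=> [/eqquotP/asboolP xy|[g Gg <-]].
  suff : orbit_of Gamma x y by case=> g Gg gx; exists g.
  by rewrite xy; exists aff_id; [exact: fdg_id|exact: aff_act_id].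
apply/eqquotP/asboolP/seteqP; split=> _ [h Gh <-].
  exists (aff_comp (aff_inv g) h); first by apply: fdg_comp => //;
    exact: fdg_inv.
  by rewrite aff_act_comp aff_actK//; exact: iso.
by exists (aff_comp g h); [exact: fdg_comp|rewrite aff_act_comp].
Qed.

Lemma orbit_proj_act g x : Gamma g -> p (aff_act g x) = p x.
Proof. by move=> Gg; apply/esym/orbit_projP; exists g. Qed.

Lemma orbit_proj_surj (q : orbit_space Gamma) : exists x, p x = q.
Proof. by exists (repr q); rewrite /orbit_proj reprK. Qed.

Lemma orbit_proj_continuous : continuous p.
Proof. exact: pi_continuous. Qed.

(** The saturation of [U] is a union of preimages of [U] under elements of the group. *)
Lemma orbit_proj_open U : open U -> open (p @` U).
Proof.
move=> oU; suff : open (p @^-1` (p @` U)) by [].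
rewrite (_ : p @^-1` _ = \bigcup_(g in Gamma) (aff_act g @^-1` U)).
  apply: bigcup_open => g _; apply: open_comp => // x _;
    exact: aff_act_continuous.
apply/seteqP; split=> x /=.
  by move=> [y Uy /esym/orbit_projP[g Gg gx]]; exists g => //=; rewrite gx.
by move=> [g Gg /= Ugx]; exists (aff_act g x) => //; rewrite orbit_proj_act.
Qed.

Lemma orbit_space_hausdorff : hausdorff_space (orbit_space Gamma).
Proof.
move=> q q'; have [x <-] := orbit_proj_surj q;
  have [y <-] := orbit_proj_surj q'.
apply: contraPP => xy clu.
have [|e e0 sep] := @orbit_separated _ _ _ HG x y.
  by move=> g Gg gx; apply: xy; apply/orbit_projP; exists g.
have m0 : 0 < (m.+1)%:R :> R by rewrite ltr0n.
(* If the two balls of radius [d] met in the quotient, some [g] would bring [x] within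
   [m * d + d = e / 2] of [y]: the first term is the Lipschitz bound of [g], the second the radius
   at [y]. *)
pose d := e / 2 / m.+1%:R.
have d0 : 0 < d by rewrite !divr_gt0.
have nb z : nbhs (p z) (p @` ball z d).
  apply: open_nbhs_nbhs; split; last by exists z => //; exact: ballxx.
  by apply: orbit_proj_open; exact: ball_open.
have [_ [[x' xx' <-] [y' yy' /orbit_projP[g Gg gy']]]] := clu _ _ (nb x) (nb y).
have Gg' := fdg_inv HG Gg.
have := sep _ Gg'; rewrite leNgt => /negP; apply.
move: xx' yy'; rewrite -ball_normE /= => xx' yy'.
have -> : aff_act (aff_inv g) x - y =
    (aff_act (aff_inv g) x - aff_act (aff_inv g) x') - (y - y').
  by rewrite -gy' aff_actK ?opprB ?addrA ?subrK//; exact: iso.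
apply: le_lt_trans (ler_normB _ _) _.
have := aff_act_lipschitz x x' (iso Gg').
have : m%:R * `|x - x'| <= m%:R * d by rewrite ler_wpM2l// ltW.
have : m.+1%:R * d = e / 2 by rewrite /d mulrC divfK// gt_eqF.
by rewrite -natr1; nra.
Qed.

(** The condition indexing the charts of [flat_quotient], named so that it also serves the suspended
    group. *)
Definition inj_nbhd U := open U /\ forall x y, U x -> U y -> p x = p y -> x = y.

Lemma inj_nbhdI U V : open V -> inj_nbhd U -> inj_nbhd (U `&` V).
Proof. by move=> oV [oU iU]; split; [exact: openI|move=> x y [+ _] [+ _];
  exact: iU]. Qed.

Lemma inj_nbhd_exists x : exists2 U, inj_nbhd U & U x.
Proof.
have [e e0 He] := orbit_isolated HG x.
have m0 : 0 < (m.+1)%:R :> R by rewrite ltr0n.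
pose d := e / m.+1%:R; have d0 : 0 < d by rewrite divr_gt0.
exists (ball x d); last exact: ballxx.
split=> [|y z xy xz /orbit_projP[g Gg gy]]; first exact: ball_open.
suff gid : g = aff_id by rewrite -gy gid aff_act_id.
apply: He => //; move: xy xz; rewrite -ball_normE /= => xy xz.
have -> : aff_act g x - x = (aff_act g x - aff_act g y) - (x - z).
  by rewrite gy opprB addrA subrK.
apply: le_lt_trans (ler_normB _ _) _.
have := aff_act_lipschitz x y (iso Gg).
have : m%:R * `|x - y| <= m%:R * d by rewrite ler_wpM2l// ltW.
have : m.+1%:R * d = e by rewrite /d mulrC divfK// gt_eqF.
by rewrite -natr1; nra.
Qed.

(** The chart map of [flat_quotient] for the set [U]; its value is 0 off the image of [U]. *)
Definition local_inv U (q : orbit_space Gamma) : 'rV[R]_m :=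
  xget 0 [set x | U x /\ p x = q].

Section LocalInverse.
Context (U : set 'rV[R]_m) (iU : inj_nbhd U).

Lemma local_invK x : U x -> local_inv U (p x) = x.
Proof.
move=> Ux; rewrite /local_inv; case: xgetP => [y _ [Uy yx]|/(_ x)].
  exact: (proj2 iU).
by move=> /(_ (conj Ux erefl)).
Qed.

Lemma local_inv_in q : (p @` U) q -> U (local_inv U q).
Proof. by move=> [x Ux <-]; rewrite local_invK. Qed.

Lemma local_inv_proj q : (p @` U) q -> p (local_inv U q) = q.
Proof. by move=> [x Ux <-]; rewrite local_invK. Qed.

Lemma local_inv_image W : W `<=` p @` U -> local_inv U @` W = U `&` p @^-1` W.
Proof.
move=> WU; apply/seteqP; split=> [_ [q Wq <-]|x [Ux Wx]].
  split; first exact/local_inv_in/WU.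
  by rewrite /preimage/= local_inv_proj//; exact: WU.
by exists (p x) => //; exact: local_invK.
Qed.

Lemma local_inv_continuous q : (p @` U) q -> {for q, continuous (local_inv U)}.
Proof.
move=> [x Ux <-] W; rewrite local_invK// => nW.
move: nW; rewrite nbhsE => -[B [oB Bx] BW].
apply: (@filterS _ _ _ (p @` (U `&` B))).
  by move=> _ [y [Uy By] <-]; rewrite /= local_invK//; exact: BW.
apply: open_nbhs_nbhs; split; last by exists x.
by apply: orbit_proj_open; apply: openI => //; case: iU.
Qed.

End LocalInverse.

(** The two lifts of [q] differ by some [g]. Wherever [g] still maps the first lift into [V],
    injectivity on [V] makes the result the second lift, so [O] is the preimage of [V] under [g]. *)
Lemma local_inv_transition U V q : inj_nbhd U -> inj_nbhd V ->
  (p @` U) q -> (p @` V) q ->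
  exists g, exists O : set 'rV[R]_m, [/\ Gamma g, open O, O (local_inv U q) &
    forall q', (p @` U) q' -> O (local_inv U q') ->
      local_inv V q' = aff_act g (local_inv U q')].
Proof.
move=> iU iV Uq Vq.
have : p (local_inv U q) = p (local_inv V q) by rewrite !local_inv_proj.
move=> /orbit_projP[g Gg gx]; exists g, (aff_act g @^-1` V); split=> //.
- by apply: open_comp (proj1 iV) => x _; exact: aff_act_continuous.
- by rewrite /= gx; exact: local_inv_in.
- by move=> q' Uq' Vgq';
  rewrite -[in LHS](local_inv_proj iU Uq') -(orbit_proj_act _ Gg) local_invK.
Qed.

End OrbitSpace.

(** * Orientability and determinants of the holonomy *)

Section Orientation.
Context {R : realType} {n : nat} (Gamma : set (@affine_map R n.+1)).
Context (HG : free_discrete_group Gamma).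
Local Notation N := (flat_quotient Gamma).

Lemma flat_quotient_chart (i : chart_idx N) : is_chart (atlas i : chart N R
  n.+1).
Proof.
case: i => U iU; split=> /=.
- by apply: (orbit_proj_open HG); case: iU.
- by move=> q q' Uq Uq' e;
  rewrite -(local_inv_proj iU Uq) -(local_inv_proj iU Uq') /local_inv e.
- by move=> q Uq; exact: (local_inv_continuous HG iU).
- left => W oW WU; rewrite [X in open X](local_inv_image iU WU).
  by apply: openI; [case: iU|apply: open_comp oW => x _;
    exact: orbit_proj_continuous].
Qed.

Lemma flat_quotient_transition (i j : chart_idx N) (q : N) :
  chart_dom (atlas i) q -> chart_dom (atlas j) q ->
  exists2 g, Gamma g &
    coord_expr (atlas i) (chart_dom (atlas j)) (atlas j) q (aff_act g).
Proof.
case: i j => U iU [V iV] /= Uq Vq.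
have [g [B [Gg oB Bq gB]]] := local_inv_transition HG iU iV Uq Vq.
exists g => //; exists B; split=> //; first exact: affine_smooth.
by move=> q' Uq' _ Bq'; apply/esym; exact: gB.
Qed.

(** Transition maps between the standard charts are locally elements of the group, whose Jacobian is
    the linear part; so the standard atlas is already oriented. *)
Lemma flat_quotient_orientable :
  (forall g, Gamma g -> 0 < \det g.1) -> orientable N.
Proof.
move=> pos; exists (range (fun i : chart_idx N => atlas i)); split.
- move=> q; have [x <-] := orbit_proj_surj q.
  have [U iU Ux] := inj_nbhd_exists HG x.
  by exists (atlas (exist _ U iU : chart_idx N));
    [exists (exist _ U iU)|exists x].
- by move=> _ [i _ <-]; exact: flat_quotient_chart.
- move=> _ i [j _ <-]; split=> q iq jq.
    by have [g _ ?] := flat_quotient_transition iq jq; exists (aff_act g).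
  by have [g _ ?] := flat_quotient_transition iq jq; exists (aff_act g).
- move=> _ _ q [i _ <-] [j _ <-] iq jq.
  have [g Gg ?] := flat_quotient_transition iq jq; exists (aff_act g) => //.
  by rewrite jacobian_affine pos.
Qed.

Lemma nonorientable_det : ~ orientable N -> exists2 g, Gamma g & \det g.1 = -1.
Proof.
move=> nor; apply: contrapT => no; apply: nor; apply: flat_quotient_orientable.
move=> g Gg; have : \det g.1 ^+ 2 == 1.
  by have /(congr1 determinant) := fdg_isometry HG Gg;
    rewrite det_mulmx det_tr det1 expr2 => ->.
rewrite sqrf_eq1 => /orP[/eqP-> //|/eqP d1].
by exfalso; apply: no; exists g.
Qed.

End Orientation.

(** * Extension of the action to one more dimension by flips of the height *)

Section Suspension.
Context {R : realType} {m : nat}.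
Implicit Types (x y : 'rV[R]_m) (z c d : R) (A B : 'M[R]_m).
Implicit Types (g h : @affine_map R m).

(** The added coordinate comes last because [half_space] is cut out by the coordinate [ord_max]. *)
Definition row_ext x z : 'rV[R]_m.+1 :=
  \row_j oapp (x 0) z (unlift ord_max j).

Definition height (v : 'rV[R]_m.+1) : R := v 0 ord_max.

Definition base (v : 'rV[R]_m.+1) : 'rV[R]_m := col' ord_max v.

Lemma height_ext x z : height (row_ext x z) = z.
Proof. by rewrite /height mxE unlift_none. Qed.

Lemma base_ext x z : base (row_ext x z) = x.
Proof. by apply/rowP => j; rewrite !mxE liftK. Qed.

Lemma row_ext_eta (v : 'rV[R]_m.+1) : row_ext (base v) (height v) = v.
Proof.
apply/rowP => j; rewrite /base /height mxE.
by case: unliftP => [k ->|->] //=; rewrite mxE.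
Qed.

Lemma row_ext_inj x y z z' : row_ext x z = row_ext y z' -> x = y /\ z = z'.
Proof.
move=> e; move: (congr1 base e) (congr1 height e).
by rewrite !base_ext !height_ext.
Qed.

Lemma row_extD x y z z' : row_ext x z + row_ext y z' = row_ext (x + y) (z + z').
Proof.
by apply/rowP => j; rewrite !mxE; case: unliftP => [k _|_] //=; rewrite mxE.
Qed.

(** The block-diagonal matrix with blocks [A] and [c], given entrywise so that its size is literally
    [m.+1]. *)
Definition mx_ext A c : 'M[R]_m.+1 := \matrix_(i, j)
  match unlift ord_max i, unlift ord_max j with
  | Some a, Some b => A a b
  | None, None => c
  | _, _ => 0
  end.

Lemma mx_extE A c :
  [/\ forall i j, mx_ext A c (lift ord_max i) (lift ord_max j) = A i j,
      forall i, mx_ext A c (lift ord_max i) ord_max = 0,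
      forall j, mx_ext A c ord_max (lift ord_max j) = 0 &
      mx_ext A c ord_max ord_max = c].
Proof. by split=> *; rewrite mxE ?liftK ?unlift_none /= ?liftK ?unlift_none.
  Qed.

Lemma mul_row_ext x z A c : row_ext x z *m mx_ext A c = row_ext (x *m A) (z *
  c).
Proof.
have [Ell Elm Eml Emm] := mx_extE A c.
apply/rowP => j; rewrite !mxE (bigD1_ord ord_max)//= mxE unlift_none /=.
case: unliftP => [k ->|->] /=.
  rewrite Eml mulr0 add0r mxE; apply: eq_bigr => i _.
  by rewrite Ell mxE liftK.
by rewrite Emm big1 ?addr0// => i _; rewrite Elm mulr0.
Qed.

Lemma mul_mx_ext A B c d : mx_ext A c *m mx_ext B d = mx_ext (A *m B) (c * d).
Proof.
have [All Alm Aml Amm] := mx_extE A c; have [Bll Blm Bml Bmm] := mx_extE B d.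
have [Cll Clm Cml Cmm] := mx_extE (A *m B) (c * d).
apply/matrixP => i j; rewrite [LHS]mxE (bigD1_ord ord_max)//=.
case: (unliftP ord_max i) => [a ->|->]; case: (unliftP ord_max j) => [b ->|->].
- rewrite Cll Alm mul0r add0r mxE; apply: eq_bigr => k _.
  by rewrite All Bll.
- by rewrite Clm Alm mul0r add0r big1// => k _; rewrite Blm mulr0.
- by rewrite Cml Bml mulr0 add0r big1// => k _; rewrite Aml mul0r.
- by rewrite Cmm Amm Bmm big1 ?addr0// => k _; rewrite Aml mul0r.
Qed.

Lemma tr_mx_ext A c : (mx_ext A c)^T = mx_ext A^T c.
Proof.
by apply/matrixP => i j; rewrite !mxE; case: unliftP => [a _|_];
  case: unliftP => [b _|_]; rewrite ?mxE.
Qed.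

Lemma mx_ext1 : mx_ext 1%:M 1 = 1%:M.
Proof.
have [Ell Elm Eml Emm] := mx_extE 1%:M 1.
apply/matrixP => i j; case: (unliftP ord_max i) => [a ->|->];
  case: (unliftP ord_max j) => [b ->|->].
- by rewrite Ell !mxE (inj_eq lift_inj).
- by rewrite Elm !mxE eq_sym (negPf (neq_lift _ _)).
- by rewrite Eml !mxE (negPf (neq_lift _ _)).
- by rewrite Emm !mxE eqxx.
Qed.

Context (Gamma Delta : set (@affine_map R m)).
Context (HD : free_discrete_group Delta).
Context (Gid : Gamma aff_id).
Context (Gcomp : forall g h, Delta g -> Delta h ->
  Gamma (aff_comp g h) <-> (Gamma g <-> Gamma h)).

(** The hypothesis [Gcomp] says that membership in [Gamma] is a homomorphism from [Delta] to the
    group of order two; its non-trivial value acts on heights by reversing the interval from 0 to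
    2. *)
Definition flip g z : R := if `[< Gamma g >] then z else 2 - z.

Definition suspend g : @affine_map R m.+1 :=
  (mx_ext g.1 (if `[< Gamma g >] then 1 else -1), row_ext g.2 (flip g 0)).

Definition suspension : set (@affine_map R m.+1) := suspend @` Delta.

Lemma suspend_act g x z :
  aff_act (suspend g) (row_ext x z) = row_ext (aff_act g x) (flip g z).
Proof.
rewrite /aff_act /= mul_row_ext row_extD /flip; congr row_ext.
by case: asbool; rewrite ?mulr1 ?addr0// mulrN1 subr0 addrC.
Qed.

Lemma suspend_act_eta g v :
  aff_act (suspend g) v = row_ext (aff_act g (base v)) (flip g (height v)).
Proof. by rewrite -suspend_act row_ext_eta. Qed.

Lemma suspend_id : suspend aff_id = aff_id.
Proof.
rewrite /suspend /flip (asboolT Gid) mx_ext1; congr pair.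
by apply/rowP => j; rewrite !mxE; case: unliftP => [k _|_] //=; rewrite mxE.
Qed.

Lemma suspend_comp g h : Delta g -> Delta h ->
  aff_comp (suspend g) (suspend h) = suspend (aff_comp g h).
Proof.
move=> Dg Dh; rewrite /aff_comp /suspend /= mul_mx_ext mul_row_ext row_extD
  /flip /=.
have := Gcomp Dg Dh; rewrite /aff_comp.
case: (asboolP (Gamma g)) => Gg; case: (asboolP (Gamma h)) => Gh;
  case: asboolP => Ggh H; try tauto; congr (mx_ext _ _, row_ext _ _);
  by rewrite ?(oppr0, mulr1, mul1r, mulrN1, mulrNN, opprK, addr0, mul0r, subr0,
    add0r, addNr).
Qed.

Lemma suspend_isometry g : is_affine_isometry g ->
  is_affine_isometry (suspend g).
Proof.
rewrite /is_affine_isometry /= tr_mx_ext mul_mx_ext => ->.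
by case: asbool; rewrite ?mulr1 ?mulrNN ?mulr1 mx_ext1.
Qed.

Lemma suspension_free_discrete : free_discrete_group suspension.
Proof.
have iso := fdg_isometry HD.
split.
- by move=> _ [g Dg <-]; apply: suspend_isometry; exact: iso.
- by exists aff_id; [exact: fdg_id|exact: suspend_id].
- move=> _ _ [g Dg <-] [h Dh <-]; exists (aff_comp g h);
  last exact/esym/suspend_comp.
  exact: fdg_comp.
- move=> _ [g Dg <-]; have Dg' := fdg_inv HD Dg; exists (aff_inv g) => //.
  apply: aff_comp_inv_uniq; first by apply: suspend_isometry; exact: iso.
  by rewrite suspend_comp// aff_compV ?suspend_id//; exact: iso.
- have [e e0 He] := fdg_discrete HD; exists (Num.min e 1);
  first by rewrite lt_min e0 ltr01.
  move=> _ [g Dg <-]; rewrite !lt_min => /andP[ge g1] /andP[be _].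
  suff gid : g = aff_id by rewrite gid suspend_id.
  (* An element outside [Gamma] has last diagonal entry -1, at distance 2 from that of the identity,
     which the bound 1 excludes. *)
  have Gg : Gamma g.
    apply: contrapT => nG; move: g1.
    have := mx_norm_coord ((suspend g).1 - 1%:M) ord_max ord_max.
    rewrite /= (asboolF nG) !mxE eqxx unlift_none mulr1n -opprD normrN.
    by rewrite ger0_norm// => h1 h2; lra.
  apply: He => //.
    apply: le_lt_trans ge; apply/mx_norm_leP => // i j.
    have := mx_norm_coord ((suspend g).1 - 1%:M) (lift ord_max i) (lift ord_max
      j).
    by rewrite !mxE !liftK (inj_eq lift_inj).
  apply: le_lt_trans be; apply/mx_norm_leP => // i j.
  have := mx_norm_coord (suspend g).2 i (lift ord_max j).
  by rewrite mxE liftK /= ord1.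
- move=> _ v [g Dg <-];
  rewrite suspend_act_eta -[RHS]row_ext_eta => /row_ext_inj[gx _].
  by rewrite (fdg_free HD Dg gx) suspend_id.
Qed.

End Suspension.

(** * Subspaces, countable bases, clamping and compactness *)

Section Topology.

Lemma set_val_continuous {X : topologicalType} (A : set X) :
  continuous (@set_val X A).
Proof. exact: initial_continuous. Qed.

Lemma set_val_inj {T : Type} (A : set T) : injective (@set_val T A).
Proof. exact: val_inj. Qed.

Lemma set_type_continuous {X Y : topologicalType} (A : set Y) (f : X ->
  set_type A) :
  continuous (set_val \o f) -> continuous f.
Proof.
move=> /continuousP cf; apply/continuousP => _ [B oB <-].
exact: cf.
Qed.

Lemma set_type_hausdorff {X : topologicalType} (A : set X) :
  hausdorff_space X -> hausdorff_space (set_type A).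
Proof.
move=> hX p q pq; apply/val_inj/hX => B C pB qC.
have [||r [Br Cr]] := pq (set_val @^-1` B) (set_val @^-1` C).
- exact: (@set_val_continuous X A p B pB).
- exact: (@set_val_continuous X A q C qC).
- by exists (set_val r).
Qed.

Lemma rV_connected {R : realType} n : connected [set: 'rV[R]_n].
Proof.
rewrite (_ : [set: _] = \bigcup_(v : 'rV[R]_n) range (fun t : R => t *: v)).
  apply: bigcup_connected; first by exists 0 => v _; exists 0 => //;
    rewrite scale0r.
  move=> v _; apply: connected_continuous_connected.
    by rewrite -set_itvNyy; apply/connected_intervalP;
      exact: interval_is_interval.
  by apply: continuous_subspaceT => t; exact: scalel_continuous.
by apply/seteqP; split=> // v _; exists v => //; exists 1 => //;
  rewrite scale1r.
Qed.

Definition rat_row {R : realType} {n} (q : 'rV[rat]_n) : 'rV[R]_n :=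
  map_mx ratr q.

Lemma rational_ball {R : realType} n (x : 'rV[R]_n) (e : R) : 0 < e ->
  exists (q : 'rV[rat]_n) (k : nat),
    ball (rat_row q : 'rV[R]_n) k.+1%:R^-1 x /\ ball (rat_row q : 'rV[R]_n)
      k.+1%:R^-1 `<=` ball x e.
Proof.
move=> e0; have e20 : 0 < e / 2 by rewrite divr_gt0.
have [k] := ltr_add_invr e20; rewrite add0r => ke.
have k0 : 0 < k.+1%:R^-1 :> R by rewrite invr_gt0 ltr0n.
have close i : exists q : rat, `|ratr q - x 0 i| < k.+1%:R^-1.
  have [||r [+ [q _ qr]]] := @dense_rat R (ball (x 0 i) k.+1%:R^-1).
  - by exists (x 0 i); exact: ballxx.
  - exact: ball_open.
  - by rewrite -qr -ball_normE /= distrC => ?; exists q.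
exists (\row_i xchoose (close i)), k.
have xq : ball (rat_row (\row_i xchoose (close i))) k.+1%:R^-1 x.
  split=> // i j; rewrite !mxE ord1 -ball_normE.
  exact: (xchooseP (close j)).
split=> // y qy; rewrite (splitr e);
  apply: (@ball_triangle _ _ (rat_row (\row_i xchoose (close i)))).
  by apply/ball_sym; apply: le_ball xq; exact: ltW.
by apply: le_ball qy; exact: ltW.
Qed.

(** A countable base consists of the traces on [A] of the images of balls with rational centre and
    radius [1 / (k + 1)]. *)
Lemma second_countable_open_image {R : realType} {n} {T : topologicalType}
    (A : set T) (f : 'rV[R]_n -> T) : continuous f ->
  (forall U, open U -> open (f @` U)) -> A `<=` range f ->
  @second_countable (set_type A).
Proof.
move=> cf of_ Af.
pose B (s : 'rV[rat]_n * nat) : set (set_type A) :=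
  set_val @^-1` (f @` ball (rat_row s.1 : 'rV[R]_n) s.2.+1%:R^-1).
exists (range B); first by apply: card_le_trans (card_image_le _ _) _;
  exact: countableP.
split.
  move=> _ [s _ <-]; apply: open_comp; first by move=> ? _;
    exact: set_val_continuous.
  by apply: of_; exact: ball_open.
move=> a V; rewrite nbhsE => -[W [[C oC <-] Ca] CV].
have [x _ xa] : range f (set_val a) by apply: Af; exact: set_valP.
have : nbhs x (f @^-1` C) by apply: cf; rewrite xa; exact: open_nbhs_nbhs.
move=> /nbhs_ballP[e /= e0 eC].
have [q [k [qx qe]]] := rational_ball x e0.
exists (B (q, k)); first by split; [exists (q, k)|exists x].
by move=> b [y qy yb]; apply: CV; rewrite /= -yb; exact/eC/qe.
Qed.

Lemma lipschitz1_continuous {R : realType} {V W : normedModType R} (f : V -> W)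
  :
  (forall x y, `|f x - f y| <= `|x - y|) -> continuous f.
Proof.
move=> fl x; apply/cvgrPdist_lt => e e0.
apply/nbhs_ballP; exists e => //= y; rewrite -ball_normE /=.
exact: le_lt_trans.
Qed.

Lemma row_ext_continuous {R : realType} m z : continuous (row_ext ^~ z :
  'rV[R]_m -> _).
Proof.
apply: (@lipschitz1_continuous R 'rV[R]_m 'rV[R]_m.+1) => x y.
apply/mx_norm_leP => // i j; rewrite !mxE; case: unliftP => [k _|_] /=.
  by have := mx_norm_coord (x - y) 0 k; rewrite !mxE.
by rewrite subrr normr0.
Qed.

Lemma base_lipschitz {R : realType} m (v w : 'rV[R]_m.+1) :
  `|base v - base w| <= `|v - w|.
Proof.
apply/mx_norm_leP => // i j; rewrite !mxE.
by have := mx_norm_coord (v - w) i (lift ord_max j); rewrite !mxE.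
Qed.

Lemma base_continuous {R : realType} m : continuous (@base R m).
Proof. by apply: (@lipschitz1_continuous R 'rV[R]_m.+1 'rV[R]_m);
  exact: base_lipschitz. Qed.

Lemma height_lipschitz {R : realType} m (v w : 'rV[R]_m.+1) :
  `|height v - height w| <= `|v - w|.
Proof. by have := mx_norm_coord (v - w) 0 ord_max; rewrite !mxE. Qed.

Lemma height_continuous {R : realType} m : continuous (@height R m).
Proof. by apply: (@lipschitz1_continuous R 'rV[R]_m.+1 R);
  exact: height_lipschitz. Qed.

(** This retracts R^(m+1) onto the slab of heights between 0 and 2, so that the bundle becomes a
    continuous image of the whole space. *)
Lemma row_ext_clamp_continuous {R : realType} m :
  continuous (fun v : 'rV[R]_m.+1 => row_ext (base v) (Num.max 0 (Num.min
    (height v) 2))).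
Proof.
apply: (@lipschitz1_continuous R 'rV[R]_m.+1 'rV[R]_m.+1) => v w.
apply/mx_norm_leP => // i j; rewrite !mxE; case: unliftP => [k _|_] /=.
  by rewrite !mxE; have := mx_norm_coord (v - w) 0 (lift ord_max k);
    rewrite !mxE.
apply: le_trans (height_lipschitz v w).
move: (height v) (height w) => a b.
have m2 : Num.max 0 2 = 2 :> R by apply/max_idPr.
case: (leP a 2) => a2; case: (leP b 2) => b2; case: (leP 0 a) => a0;
  case: (leP 0 b) => b0.
all: rewrite ?m2 ler_norml; have := ler_norm (a - b); have := ler_norm (b - a).
all: rewrite [`|b - a|]distrC => h1 h2; apply/andP; split; lra.
Qed.

End Topology.

Lemma cocompact_bounded {R : realType} {m : nat} (Gamma : set (@affine_map R
  m)) :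
  free_discrete_group Gamma -> compact [set: orbit_space Gamma] ->
  exists2 C : R, 0 < C & forall y, exists2 g, Gamma g & `|aff_act g y| < C.
Proof.
move=> HG; rewrite compact_cover.
pose f (k : nat) : set (orbit_space Gamma) := orbit_proj Gamma @` ball (0 :
  'rV[R]_m) k.+1%:R.
move=> /(_ nat setT f)[k _||D _ Df].
- by apply: (orbit_proj_open HG); exact: ball_open.
- move=> q _; have [x <-] := orbit_proj_surj q.
  exists (Num.truncn `|x|) => //; exists x => //;
    rewrite -ball_normE /= sub0r normrN.
  by rewrite truncnS_gt.
(* The sum of the finitely many radii serves as an upper bound for each of them. *)
exists (\sum_(k <- finmap.enum_fset D) k.+1%:R + 1).
  by rewrite ltr_wpDl// sumr_ge0.
move=> y; have [k kD [x kx]] := Df (orbit_proj Gamma y) I.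
move=> /esym/(orbit_projP HG)[g Gg gy]; exists g => //; rewrite gy.
move: kx; rewrite -ball_normE /= sub0r normrN => kx.
apply: lt_le_trans kx _; rewrite (bigD1_seq k)//= -addrA lerDl.
by rewrite addr_ge0// sumr_ge0.
Qed.

(** * Vanishing of the curvatures of a constant metric *)

Section EuclideanGram.
Context {R : realType} {n : nat}.

Lemma christoffel_cst (A : 'M[R]_n) k i j : christoffel (fun=> A) k i j = fun=>
  0.
Proof.
apply/funext => x; rewrite /christoffel big1 ?mulr0// => l _.
by rewrite /partial !derive_cst !addr0 subr0 mulr0.
Qed.

Lemma riemann_curvature_cst (A : 'M[R]_n) l k i j x :
  riemann_curvature (fun=> A) l k i j x = 0.
Proof.
rewrite /riemann_curvature !christoffel_cst /partial !derive_cst subrr add0r.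
by rewrite big1// => a _; rewrite !christoffel_cst mul0r subrr.
Qed.

Lemma coord_expr_cst {T : Type} {V : normedModType R} (c : chart T R n) p (w :
  V) :
  coord_expr c setT (fun=> w) p (fun=> w).
Proof. by exists setT; split=> //; [exact: openT|exact: smooth_on_cst]. Qed.

End EuclideanGram.

Lemma second_fundamental_form_cst {R : realType} {n : nat} (A : 'M[R]_n.+1) a b
  x :
  second_fundamental_form (fun=> A) a b x = 0.
Proof. by rewrite /second_fundamental_form christoffel_cst mul0r. Qed.

(** * The twisted interval bundle and its boundary *)

Section TwistedBundle.
Context {R : realType} {m : nat} (Gamma Delta : set (@affine_map R m)).
Context (HD : free_discrete_group Delta).
Context (GD : Gamma `<=` Delta) (Gid : Gamma aff_id).
Context (Gcomp : forall g h, Delta g -> Delta h ->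
  Gamma (aff_comp g h) <-> (Gamma g <-> Gamma h)).
Context (tau : @affine_map R m) (Dtau : Delta tau) (nGtau : ~ Gamma tau).
Context (cG : compact [set: orbit_space Gamma]).

Lemma index2_free_discrete : free_discrete_group Gamma.
Proof.
have iso := fdg_isometry HD.
split=> //.
- by move=> g /GD; exact: iso.
- by move=> g h Gg Gh; apply: (iffRL (Gcomp (GD Gg) (GD Gh))).
- move=> g Gg; have Dg := GD Gg; have Dg' := fdg_inv HD Dg.
  apply: (proj1 (iffLR (Gcomp Dg Dg') _)) => //.
  by rewrite aff_compV//; exact: iso.
- by have [e e0 He] := fdg_discrete HD; exists e => // g /GD; exact: He.
- by move=> g x /GD; exact: (fdg_free HD).
Qed.

Let HG := index2_free_discrete.
Let S := suspension Gamma Delta.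
Let HS : free_discrete_group S := suspension_free_discrete HD Gid Gcomp.
Local Notation P := (orbit_proj S).
Local Notation p := (orbit_proj Gamma).

Lemma flip_range g z : 0 <= z <= 2 -> 0 <= flip Gamma g z <= 2.
Proof. by rewrite /flip; case: asbool => // /andP[? ?]; apply/andP; split;
  lra. Qed.

(** The bundle is carved out of the quotient of all of R^(m+1), so the results on free discrete
    actions apply without a boundary. *)
Definition strip : set (orbit_space S) := P @` [set v | 0 <= height v <= 2].

Lemma strip_proj v : strip (P v) <-> 0 <= height v <= 2.
Proof.
split=> [[w hw]|hv]; last by exists v.
move=> /(orbit_projP HS)[_ [g Dg <-]] <-.
by rewrite suspend_act_eta height_ext; exact: flip_range.
Qed.

(* Elements of [Delta] outside [Gamma] exchange the heights 0 and 2, so the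
   charts can avoid height 2; all of them are then half-space charts. *)
Definition twisted_bundle : riem_data R m.+1 :=
  @RiemData R m.+1 (set_type strip)
    {U : set 'rV[R]_m.+1 | inj_nbhd S U /\ U `<=` [set v | height v < 2]}
    (fun U => Chart [set q | (P @` sval U) (set_val q)]
       (fun q => local_inv (sval U) (set_val q)))
    (fun _ _ => 1%:M).

Local Notation M := twisted_bundle.

Lemma nbhd_below v : height v < 2 ->
  exists i : chart_idx M, (sval i) v.
Proof.
move=> hv; have [U iU Uv] := inj_nbhd_exists HS v.
have ob : open [set w : 'rV[R]_m.+1 | height w < 2].
  apply: (@open_comp _ _ (@height R m) [set z | z < 2]); last exact: open_lt.
  by move=> w _; exact: height_continuous.
unshelve eexists; first exists (U `&` [set w | height w < 2]).
  by split=> [|w []//]; exact: inj_nbhdI.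
by [].
Qed.

Lemma tau_flip z : flip Gamma tau z = 2 - z.
Proof. by rewrite /flip asboolF. Qed.

(** A representative of height 2 is carried to height 0 by [tau]. *)
Lemma strip_below (q : M) : exists2 v, P v = set_val q & 0 <= height v < 2.
Proof.
have [v /= /andP[v0 v2] vq] := set_valP q.
have [lt2|ge2] := ltP (height v) 2; first by exists v => //; rewrite v0.
exists (aff_act (suspend Gamma tau) v).
  by rewrite (orbit_proj_act HS)//; exists tau.
by rewrite suspend_act_eta height_ext tau_flip; apply/andP; split; lra.
Qed.

Lemma twisted_bundle_cover (q : M) : exists i : chart_idx M, chart_dom (atlas
  i) q.
Proof.
have [v vq /andP[_ v2]] := strip_below q.
by have [i iv] := nbhd_below v2; exists i; exists v.
Qed.

(** Of the two bounds on the height, the upper one holds throughout [U], so only the condition of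
    being non-negative cuts the image of a chart. *)
Lemma twisted_bundle_half_chart (i : chart_idx M) : half_chart (atlas i : chart
  M R m.+1).
Proof.
case: i => U iUU W [A oA <-] /= AU; have [iU U2] := iUU;
  exists (U `&` P @^-1` A).
  apply: openI; first by case: iU.
  by apply: open_comp oA => v _; exact: orbit_proj_continuous.
apply/seteqP; split=> [_ [q Aq <-]|v [[Uv Av] v0]] /=.
  have Uq := AU _ Aq; split.
    split; first exact: (local_inv_in iU).
    by rewrite /preimage /= (local_inv_proj iU).
  suff : strip (P (local_inv U (set_val q))) by move/strip_proj/andP => [].
  by rewrite (local_inv_proj iU)//; exact: set_valP.
have sv : strip (P v) by apply/strip_proj/andP; split=> //; exact/ltW/U2.
exists (SigSub (mem_set sv)) => //=.
exact: local_invK.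
Qed.

Lemma twisted_bundle_chart (i : chart_idx M) : is_chart (atlas i : chart M R
  m.+1).
Proof.
have hi := @twisted_bundle_half_chart i; case: i hi => U iUU hi;
  have [iU U2] := iUU.
split=> /=; last by right.
- apply: (@open_comp _ _ (@set_val _ strip) (P @` U)).
    by move=> q _; exact: set_val_continuous.
  by apply: (orbit_proj_open HS); case: iU.
- move=> q q' Uq Uq' e; apply: val_inj.
  by have := congr1 P e; rewrite !(local_inv_proj iU).
- move=> q Uq; apply: (@continuous_comp _ _ _ (@set_val _ strip) (local_inv U)).
    exact: set_val_continuous.
  exact: (local_inv_continuous HS iU).
Qed.

Lemma twisted_bundle_transition (i j : chart_idx M) (q : M) :
  chart_dom (atlas i) q -> chart_dom (atlas j) q ->
  exists2 g, is_affine_isometry g &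
    coord_expr (atlas i) (chart_dom (atlas j)) (atlas j) q (aff_act g).
Proof.
case: i j => U [iU U2] [V [iV V2]] /= Uq Vq.
have [g [B [Sg oB Bq gB]]] := local_inv_transition HS iU iV Uq Vq.
exists g; first exact: (fdg_isometry HS).
exists B; split=> //; first exact: affine_smooth.
by move=> q' Uq' _ Bq'; apply/esym; exact: gB.
Qed.

Lemma clamp_strip (v : 'rV[R]_m.+1) :
  strip (P (row_ext (base v) (Num.max 0 (Num.min (height v) 2)))).
Proof.
by apply/strip_proj; rewrite height_ext le_max lexx ge_max ge_min lexx orbT
  ler0n.
Qed.

Definition clamp_proj (v : 'rV[R]_m.+1) : M :=
  SigSub (mem_set (clamp_strip v)).

Lemma clamp_proj_continuous : continuous clamp_proj.
Proof.
apply: set_type_continuous => v.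
exact: (continuous_comp (@row_ext_clamp_continuous R m v)
  (@orbit_proj_continuous R m.+1 S _)).
Qed.

Lemma clamp_projE v : 0 <= height v <= 2 -> set_val (clamp_proj v) = P v.
Proof.
move=> /andP[v0 v2] /=; congr P; rewrite -[RHS]row_ext_eta; congr row_ext.
by rewrite min_l// max_r.
Qed.

Lemma clamp_proj_surj (q : M) : exists2 v, 0 <= height v <= 2 & clamp_proj v =
  q.
Proof.
have [v vq /andP[v0 /ltW v2]] := strip_below q.
exists v; first by rewrite v0.
by apply: set_val_inj; rewrite clamp_projE ?v0.
Qed.

Lemma twisted_bundle_connected : connected [set: M].
Proof.
rewrite (_ : [set: M] = clamp_proj @` setT); last first.
  by apply/seteqP; split=> // q _; have [v _ <-] := clamp_proj_surj q; exists v.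
apply: connected_continuous_connected; first exact: rV_connected.
exact/continuous_subspaceT/clamp_proj_continuous.
Qed.

Lemma twisted_bundle_compact : compact [set: M].
Proof.
have [C C0 HC] := cocompact_bounded HG cG.
pose K := [set v : 'rV[R]_m.+1 | `|v| <= C + 2].
rewrite (_ : [set: M] = clamp_proj @` K).
  apply: continuous_compact;
    first exact/continuous_subspaceT/clamp_proj_continuous.
  apply: bounded_closed_compact.
    by exists (C + 2); split=> [|z Cz v /= vC];
      [exact: num_real|exact: le_trans vC (ltW Cz)].
  apply: (@closed_comp _ _ (fun v : 'rV[R]_m.+1 => `|v|) [set z : R | z <= C +
    2]).
    by move=> v _; exact: norm_continuous.
  exact: closed_le.
apply/seteqP; split=> // q _; have [v v02 <-] := clamp_proj_surj q.
have [g Gg gC] := HC (base v).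
(* [Gamma] preserves the height, which is at most 2, so it suffices to move the base into a bounded
   set. *)
exists (row_ext (aff_act g (base v)) (height v)).
  apply/mx_norm_leP => [|i j]; first by rewrite addr_ge0// ltW.
  rewrite mxE; case: unliftP => [k _|_] /=.
    by rewrite (le_trans (mx_norm_coord _ _ _))// (le_trans (ltW gC))// lerDl.
  by case/andP: v02 => v0 v2; rewrite ger0_norm//; lra.
apply: set_val_inj; rewrite !clamp_projE ?height_ext//.
have -> : height v = flip Gamma g (height v) by rewrite /flip asboolT.
by rewrite -suspend_act_eta (orbit_proj_act HS)//; exists g => //; exact: GD.
Qed.

Lemma twisted_bundle_riemannian : is_riemannian M.
Proof.
split.
- exact/set_type_hausdorff/(orbit_space_hausdorff HS).
- apply: (@second_countable_open_image R m.+1 _ strip P).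
  + exact: orbit_proj_continuous.
  + by move=> U; exact: orbit_proj_open.
  + by move=> _ [v _ <-]; exists v.
- exact: twisted_bundle_connected.
- exact: twisted_bundle_cover.
- exact: twisted_bundle_chart.
- by move=> i j q iq jq; have [g _ ?] := twisted_bundle_transition iq jq;
  exists (aff_act g).
- by move=> i q iq; exists (fun=> 1%:M); exact: coord_expr_cst.
- by move=> i q iq; rewrite /= trmx1.
- move=> i q iq v v0; rewrite /= mulmx1 mxE.
  rewrite (_ : \sum_j _ = \sum_j v 0 j ^+ 2); last by apply: eq_bigr => k _;
    rewrite mxE.
  rewrite lt_neqAle eq_sym sumr_ge0 ?andbT => [|k _]; last exact: sqr_ge0.
  apply: contra v0 => /eqP /psumr_eq0P s0; apply/eqP/rowP => k; rewrite mxE.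
  by apply/eqP; rewrite -sqrf_eq0 s0// => ? _; exact: sqr_ge0.
- move=> i j q iq jq; have [g gi gc] := twisted_bundle_transition iq jq;
  exists (aff_act g) => //.
  by rewrite /pullback jacobian_affine /= mulmx1 gi.
Qed.

Lemma twisted_bundle_flat : flat M.
Proof.
move=> i q iq; exists (fun=> 1%:M); first exact: coord_expr_cst.
by move=> *; exact: riemann_curvature_cst.
Qed.

Lemma twisted_bundle_geodesic : totally_geodesic_boundary M.
Proof.
move=> i q iq; exists (fun=> 1%:M); first exact: coord_expr_cst.
by move=> *; exact: second_fundamental_form_cst.
Qed.

Lemma flip0 g z : z < 2 -> flip Gamma g z = 0 -> Gamma g /\ z = 0.
Proof. by rewrite /flip; case: asboolP => [? _ //|_ z2 zE]; exfalso; lra. Qed.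

(** Here the boundary is seen to be the quotient by [Gamma] and not by [Delta]: an element outside
    [Gamma] sends a height below 2 to a positive one, so only [Gamma] can reach height 0. *)
Lemma bottom_proj v x : height v < 2 -> P v = P (row_ext x 0) ->
  v = row_ext (base v) 0 /\ p (base v) = p x.
Proof.
move=> v2 /(orbit_projP HS)[_ [g Dg <-]];
  rewrite suspend_act_eta => /row_ext_inj[gx].
move=> /(flip0 v2)[Gg v0]; split; first by rewrite -{1}(row_ext_eta v) v0.
by apply/(orbit_projP HG); exists g.
Qed.

Lemma bottom_proj_eq x y : p x = p y -> P (row_ext x 0) = P (row_ext y 0).
Proof.
move=> /(orbit_projP HG)[g Gg gx]; apply/(orbit_projP HS).
exists (suspend Gamma g); first by exists g => //; exact: GD.
by rewrite suspend_act gx /flip asboolT.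
Qed.

Lemma bottom_strip x : strip (P (row_ext x 0)).
Proof. by apply/strip_proj; rewrite height_ext lexx ler0n. Qed.

Lemma boundary_pointsP (q : M) :
  @boundary_points R m M q <-> exists x, P (row_ext x 0) = set_val q.
Proof.
split=> [[i [_]]|[x xq]].
  case: i => U iUU /= Uq h0; have [iU _] := iUU.
  exists (base (local_inv U (set_val q))).
  by rewrite -{2}(local_inv_proj iU Uq) -[in RHS](row_ext_eta (local_inv _ _))
    /height h0.
have [|i iv] := @nbhd_below (row_ext x 0); first by rewrite height_ext.
exists i; split; first exact: twisted_bundle_half_chart.
  by exists (row_ext x 0).
case: i iv => U iUU /= Ux; have [iU _] := iUU.
by rewrite -xq (local_invK iU Ux) -[LHS]/(height _) height_ext.
Qed.

Definition bottom_point x : M := SigSub (mem_set (bottom_strip x)).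

Lemma bottom_boundary x : @boundary_points R m M (bottom_point x).
Proof. by apply/boundary_pointsP; exists x. Qed.

Definition bottom x : boundary M := SigSub (mem_set (bottom_boundary x)).

Lemma bottom_val x : set_val (set_val (bottom x)) = P (row_ext x 0).
Proof. by []. Qed.

Lemma bottomP (q : boundary M) : exists x, bottom x = q.
Proof.
have /boundary_pointsP[x xq] := set_valP q.
by exists x; do 2 apply: set_val_inj.
Qed.

Lemma bottom_eq x y : bottom x = bottom y <-> p x = p y.
Proof.
split=> [xy|xy]; last by do 2 apply: set_val_inj; exact: bottom_proj_eq.
have e : P (row_ext x 0) = P (row_ext y 0) by rewrite -!bottom_val xy.
have [||_] := @bottom_proj (row_ext x 0) y => //; first by rewrite height_ext.
by rewrite base_ext.
Qed.

(** By [bottom_eq] the class does not depend on the chosen preimage. *)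
Definition boundary_to_quotient (q : boundary M) : flat_quotient Gamma :=
  p (xget 0 [set x | bottom x = q]).

Definition quotient_to_boundary (q : flat_quotient Gamma) : boundary M :=
  bottom (repr q).

Local Notation f := boundary_to_quotient.
Local Notation k := quotient_to_boundary.

Lemma boundary_to_quotientE x : f (bottom x) = p x.
Proof.
rewrite /boundary_to_quotient; case: xgetP => [y _ /bottom_eq //|/(_ x)].
by move=> /(_ erefl).
Qed.

Lemma quotient_to_boundaryE x : k (p x) = bottom x.
Proof. by apply/bottom_eq; rewrite /orbit_proj reprK. Qed.

Lemma quotient_to_boundary_continuous : continuous k.
Proof.
apply/quotient_continuous.
rewrite (_ : _ \o _ = bottom); last by apply/funext => x;
  exact: quotient_to_boundaryE.
apply: set_type_continuous; apply: set_type_continuous => x.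
exact: (continuous_comp (@row_ext_continuous R m 0 x) (@orbit_proj_continuous R
  m.+1 S _)).
Qed.

Lemma boundary_to_quotient_continuous : continuous f.
Proof.
apply/continuousP => W oW.
(* The preimage of [W] is thickened to an open set of R^(m+1). Heights from 2 on are removed, since
   at height 2 the base is related to the bottom point by an element outside [Gamma]. *)
pose B := [set v | W (p (base v))] `&` [set v : 'rV[R]_m.+1 | height v < 2].
have oB : open B.
  apply: openI.
    apply: (@open_comp _ _ (p \o @base R m) W) => // v _.
    exact: (continuous_comp (@base_continuous R m v) (@orbit_proj_continuous R
      m Gamma _)).
  apply: (@open_comp _ _ (@height R m) [set z | z < 2]); last exact: open_lt.
  by move=> w _; exact: height_continuous.
rewrite (_ : f @^-1` W = set_val @^-1` (set_val @^-1` (P @` B))).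
  apply: (@open_comp _ _ (@set_val _ (@boundary_points R m M))).
    by move=> q _; exact: set_val_continuous.
  apply: (@open_comp _ _ (@set_val _ strip)); last exact: orbit_proj_open.
  by move=> q _; exact: set_val_continuous.
apply/seteqP; split=> q; have [x <-] := bottomP q;
  rewrite /preimage /= boundary_to_quotientE.
  by move=> Wx; exists (row_ext x 0) => //; split;
    rewrite /= ?base_ext ?height_ext.
by move=> [v [Wv v2] /(bottom_proj v2)[_ <-]].
Qed.

Lemma bottom_chart (U : set 'rV[R]_m.+1) x : inj_nbhd S U ->
  U `<=` [set v | height v < 2] -> (P @` U) (P (row_ext x 0)) ->
  p (base (local_inv U (P (row_ext x 0)))) = p x /\
  U (row_ext (base (local_inv U (P (row_ext x 0)))) 0).
Proof.
move=> iU U2 Ux.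
have [|vE vx] := @bottom_proj (local_inv U (P (row_ext x 0))) x _
  (local_inv_proj iU Ux).
  exact/U2/(local_inv_in iU).
by split=> //; rewrite -vE; exact: (local_inv_in iU).
Qed.

(** Both charts lift the same point of the quotient by [Gamma], so they differ locally by an element
    of [Gamma]. This gives smoothness and preservation of the metric at once. *)
Lemma boundary_to_quotient_coord (i : chart_idx (boundary M))
    (j : chart_idx (flat_quotient Gamma)) q :
  chart_dom (atlas i) q -> chart_dom (atlas j) (f q) ->
  exists2 g, is_affine_isometry g &
    coord_expr (atlas i) (f @^-1` chart_dom (atlas j)) (fun q => atlas j (f q))
      q (aff_act g).
Proof.
have [x <-] := bottomP q; case: i j => U iUU [V iV] [_ /= Ux].
rewrite boundary_to_quotientE => Vx; have [iU U2] := iUU.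
have [bx Ub] := bottom_chart iU U2 Ux.
move: (Vx) => [y Vy]; rewrite -bx => /esym/(orbit_projP HG)[g Gg gy].
exists g; first exact: (fdg_isometry HG).
exists (aff_act g @^-1` V); split=> /=.
- by apply: open_comp (proj1 iV) => z _; exact: aff_act_continuous.
- by rewrite /preimage /= gy.
- exact: affine_smooth.
- move=> q' [_ +] _; have [z <-] := bottomP q'; rewrite bottom_val => Uz Vgz.
  have [bz _] := bottom_chart iU U2 Uz.
  rewrite boundary_to_quotientE -bz -[in RHS](orbit_proj_act HG _ Gg).
  exact/esym/(local_invK iV).
Qed.

Lemma quotient_to_boundary_coord (i : chart_idx (flat_quotient Gamma))
    (j : chart_idx (boundary M)) q :
  chart_dom (atlas i) q -> chart_dom (atlas j) (k q) ->
  exists F, coord_expr (atlas i) (k @^-1` chart_dom (atlas j)) (fun q => atlas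
    j (k q)) q F.
Proof.
have [x <-] := orbit_proj_surj q; case: i j => V iV [U iUU] Vx [_ /=].
rewrite quotient_to_boundaryE bottom_val => Ux; have [iU U2] := iUU.
have [bx Ub] := bottom_chart iU U2 Ux.
have := local_inv_proj iV Vx; rewrite -[in RHS]bx => /(orbit_projP HG)[g Gg gx].
exists (aff_act g), ((fun y => row_ext (aff_act g y) 0) @^-1` U); split.
- apply: open_comp (proj1 iU) => y _.
  exact: (continuous_comp (@aff_act_continuous R m g y) (@row_ext_continuous R
    m 0 _)).
- by rewrite /preimage /= gx.
- exact: affine_smooth.
- move=> q' Vq' _ /= Ugy; rewrite -{2}(local_inv_proj iV Vq').
  rewrite quotient_to_boundaryE bottom_val.
  rewrite (@bottom_proj_eq _ (aff_act g (local_inv V q')));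
    last by rewrite (orbit_proj_act HG).
  by rewrite (local_invK iU Ugy) -[RHS]/(base _) base_ext.
Qed.

Lemma boundary_isometric : isometric (boundary M) (flat_quotient Gamma).
Proof.
exists f, k; split.
- by move=> q; have [x <-] := bottomP q;
  rewrite boundary_to_quotientE quotient_to_boundaryE.
- by move=> q; have [x <-] := orbit_proj_surj q;
  rewrite quotient_to_boundaryE boundary_to_quotientE.
- split; first exact: boundary_to_quotient_continuous.
  by move=> i j q iq jq; have [g _ ?] := boundary_to_quotient_coord iq jq;
    exists (aff_act g).
- split; first exact: quotient_to_boundary_continuous.
  by move=> i j q iq jq; exact: quotient_to_boundary_coord.
- move=> i j q iq jq; have [g gi ?] := boundary_to_quotient_coord iq jq.
  exists (aff_act g) => //; rewrite /pullback jacobian_affine /= mulmx1 gi.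
  by apply/matrixP => a b; rewrite !mxE (inj_eq lift_inj).
Qed.

Lemma index2_geodesic_boundary :
  geodesic_boundary_of_compact_flat (flat_quotient Gamma).
Proof.
exists M; split; [split|..].
- exact: twisted_bundle_riemannian.
- exact: twisted_bundle_compact.
- exact: twisted_bundle_flat.
- exact: twisted_bundle_geodesic.
- exact: boundary_isometric.
Qed.

End TwistedBundle.

(** * Dot products and reflections *)

Section DotProduct.
Context {R : realType} {m : nat}.
Implicit Types (u v w : 'rV[R]_m) (A : 'M[R]_m) (c : R).

Definition dot u v : R := (u *m v^T) 0 0.

Lemma dotE u v : dot u v = \sum_i u 0 i * v 0 i.
Proof. by rewrite /dot mxE; apply: eq_bigr => i _; rewrite mxE. Qed.

Lemma dotC u v : dot u v = dot v u.
Proof. by rewrite !dotE; apply: eq_bigr => i _; rewrite mulrC. Qed.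

Lemma dotDl u v w : dot (u + v) w = dot u w + dot v w.
Proof. by rewrite /dot mulmxDl mxE. Qed.

Lemma dotZl c u v : dot (c *: u) v = c * dot u v.
Proof. by rewrite /dot -scalemxAl mxE. Qed.

Lemma dotNl u v : dot (- u) v = - dot u v.
Proof. by rewrite -scaleN1r dotZl mulN1r. Qed.

Lemma dotZr c u v : dot u (c *: v) = c * dot u v.
Proof. by rewrite dotC dotZl dotC. Qed.

Lemma dotNr u v : dot u (- v) = - dot u v.
Proof. by rewrite dotC dotNl dotC. Qed.

Lemma dot_mulmx u v A : dot (u *m A) v = dot u (v *m A^T).
Proof. by rewrite /dot trmx_mul trmxK mulmxA. Qed.

Lemma dot_mx u v : u *m v^T = (dot u v)%:M.
Proof. by rewrite /dot -mx11_scalar. Qed.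

Lemma dot_norm u v : `|dot u v| <= m%:R * (`|u| * `|v|).
Proof. by rewrite -(mx_norm_tr v); apply: le_trans (mx_norm_mul _ _);
  exact: mx_norm_coord. Qed.

Lemma dot_eq0 u : (dot u u == 0) = (u == 0).
Proof.
apply/idP/eqP => [|->]; last by rewrite /dot mul0mx mxE.
rewrite dotE => /eqP/psumr_eq0P s0; apply/rowP => k; rewrite mxE.
by apply/eqP; rewrite -sqrf_eq0 expr2 s0// => i _; rewrite -expr2 sqr_ge0.
Qed.

Lemma dot_ge0 u : 0 <= dot u u.
Proof. by rewrite dotE; apply: sumr_ge0 => i _; rewrite -expr2 sqr_ge0. Qed.

(** The orthogonal reflection in the hyperplane normal to [u], provided that [u] is a unit
    vector. *)
Definition reflection u : 'M[R]_m := 1%:M - 2 *: (u^T *m u).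

Lemma mul_reflection v u : v *m reflection u = v - (2 * dot v u) *: u.
Proof.
by rewrite mulmxBr mulmx1 -scalemxAr mulmxA dot_mx mul_scalar_mx scalerA.
Qed.

Lemma tr_reflection u : (reflection u)^T = reflection u.
Proof. by rewrite linearB /= linearZ /= trmx_mul trmxK trmx1. Qed.

Lemma reflection_unit u : dot u u = 1 -> u *m reflection u = - u.
Proof. by move=> u1; rewrite mul_reflection u1 mulr1 scaler_nat mulr2n opprD
  addNKr. Qed.

Lemma reflection_orth u v : dot v u = 0 -> v *m reflection u = v.
Proof. by move=> uv; rewrite mul_reflection uv mulr0 scale0r subr0. Qed.

Lemma reflectionK u : dot u u = 1 -> reflection u *m reflection u = 1%:M.
Proof.
move=> u1; apply/row_matrixP => i; rewrite -[LHS]mul1mx !rowE.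
rewrite mul1mx mulmxA !mul_reflection dotDl dotNl dotZl u1 mulmx1.
rewrite -addrA -opprD -scalerDl (_ : 2 * _ + 2 * _ = 0) ?scale0r ?subr0//; ring.
Qed.

End DotProduct.

(** * Doubling the group by half of a translation along a normal *)

Section HalfTranslation.
Context {R : realType} {m : nat} (Gamma : set (@affine_map R m)).
Context (HG : free_discrete_group Gamma) (cG : compact [set: orbit_space
  Gamma]).
Implicit Types (g h d : @affine_map R m) (x v w : 'rV[R]_m).

(** What is asked of the holonomy for the extension along [n]. With [bn_invol], squares of elements
    fixing [n] are translations, which leads to translations along [n]. With [bn_axis], elements
    fixing [n] move points along an axis orthogonal to [n], and a further shift along [n] cannot
    undo this. *)
Record bounding_normal (n : 'rV[R]_m) : Prop := {
  bn_unit : dot n n = 1;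
  bn_reflection : exists2 g, Gamma g & g.1 = reflection n;
  bn_eigen : forall g, Gamma g -> n *m g.1 = n \/ n *m g.1 = - n;
  bn_invol : forall g, Gamma g -> n *m g.1 = n -> g.1 *m g.1 = 1%:M;
  bn_axis : forall g, Gamma g -> n *m g.1 = n -> g.1 <> 1%:M ->
    exists e, [/\ e *m g.1 = e, dot n e = 0 & dot g.2 e <> 0] }.

Context (n : 'rV[R]_m) (Hn : bounding_normal n).
Let iso := fdg_isometry HG.
Let n1 := bn_unit Hn.

Definition transl v : @affine_map R m := (1%:M, v).

Lemma isometry_fixT g w : Gamma g -> w *m g.1 = w -> w *m g.1^T = w.
Proof. by move=> Gg {1}<-; rewrite -mulmxA (iso Gg) mulmx1. Qed.

Lemma translD v w : Gamma (transl v) -> Gamma (transl w) -> Gamma (transl (v +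
  w)).
Proof. by move=> Gv Gw; have := fdg_comp HG Gv Gw;
  rewrite /aff_comp /= !mulmx1. Qed.

Lemma translN v : Gamma (transl v) -> Gamma (transl (- v)).
Proof. by move=> /(fdg_inv HG); rewrite /aff_inv /= trmx1 mulmx1. Qed.

Lemma translJ v g : Gamma (transl v) -> Gamma g -> Gamma (transl (v *m g.1)).
Proof.
move=> Gv Gg; have := fdg_comp HG (fdg_comp HG (fdg_inv HG Gg) Gv) Gg.
rewrite /aff_comp /= !mulmx1 (aff_isometryC (iso Gg)) mulmxDl mulNmx -mulmxA.
by rewrite (aff_isometryC (iso Gg)) mulmx1 addrAC addNr add0r.
Qed.

(** Without translations along [n], the components along [n] of the translation parts would take at
    most two values, and [Gamma] could not bring far points of the line along [n] back to a bounded
    set. *)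
Lemma transl_normal_exists : exists2 u, u != 0 & Gamma (transl (u *: n)).
Proof.
apply: contrapT => no.
have zero u : Gamma (transl (u *: n)) -> u = 0.
  by move=> Gu; apply/eqP; apply: contrapT => /negP u0; apply: no; exists u.
have [g0 Gg0 g0E] := bn_reflection Hn.
(* The square of [g] is a translation by [w]. Subtracting from [w] its image under the reflection
   leaves a translation along [n], by [2 * dot w n = 4 * dot g.2 n]. *)
have fixed g : Gamma g -> n *m g.1 = n -> dot g.2 n = 0.
  move=> Gg ng.
  have Gw : Gamma (transl (g.2 *m g.1 + g.2)).
    by have := fdg_comp HG Gg Gg; rewrite /aff_comp /= (bn_invol Hn Gg ng).
  set w := g.2 *m g.1 + g.2 in Gw.
  have wn : dot w n = 2 * dot g.2 n.
    by rewrite dotDl dot_mulmx isometry_fixT// mulr_natl mulr2n.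
  have := translD Gw (translN (translJ Gw Gg0)).
  rewrite g0E mul_reflection opprB addrC subrK => /zero.
  by rewrite wn => /eqP; rewrite !mulf_eq0 !pnatr_eq0 /= => /eqP.
(* Followed by [g0], which also flips [n], the element [g] fixes [n], so [fixed] applies. *)
have flipped g : Gamma g -> n *m g.1 = - n -> dot g.2 n = dot g0.2 n.
  move=> Gg ng; have Gg' := fdg_comp HG Gg Gg0.
  have := fixed _ Gg'; rewrite /= mulmxA ng g0E mulNmx (reflection_unit n1)
    opprK.
  move=> /(_ erefl); rewrite dotDl dot_mulmx tr_reflection (reflection_unit n1)
    dotNr.
  by move=> /eqP; rewrite addrC subr_eq0 => /eqP.
have [C C0 HC] := cocompact_bounded HG cG.
(* The images of [K *: n] have component along [n] of size at least [K - |dot g0.2 n|], which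
   exceeds by 1 the bound [m * (C * |n|)] for points of norm below [C]. *)
pose K := m%:R * (C * `|n|) + `|dot g0.2 n| + 1.
have K1 : `|dot g0.2 n| < K.
  have : 0 <= m%:R * (C * `|n|) by rewrite !mulr_ge0// ltW.
  by rewrite /K; lra.
have [g Gg gC] := HC (K *: n).
have := dot_norm (aff_act g (K *: n)) n.
have : m%:R * (`|aff_act g (K *: n)| * `|n|) <= m%:R * (C * `|n|).
  by rewrite ler_wpM2l// ler_wpM2r// ltW.
rewrite {2}/aff_act dotDl -scalemxAl dotZl.
have bound : `|dot g.2 n| <= `|dot g0.2 n| /\ `|dot (n *m g.1) n| = 1.
  have [ng|ng] := bn_eigen Hn Gg.
    by rewrite fixed// ng n1 normr0 normr1.
  by rewrite flipped// ng dotNl n1 normrN1.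
have K0 : 0 < K by exact: le_lt_trans K1.
have := ler_normB (K * dot (n *m g.1) n + dot g.2 n) (dot g.2 n).
rewrite addrK normrM (proj2 bound) mulr1 gtr0_norm//.
by move: (proj1 bound); rewrite /K; lra.
Qed.

(** Otherwise a translation along [n] could be halved for ever within [Gamma], against
    discreteness. *)
Lemma half_transl_exists :
  exists s, Gamma (transl ((2 * s) *: n)) /\ ~ Gamma (transl (s *: n)).
Proof.
have [u u0 Gu] := transl_normal_exists.
apply: contrapT => no.
have half t : Gamma (transl (t *: n)) -> Gamma (transl ((t / 2) *: n)).
  move=> Gt; apply: contrapT => nG; apply: no; exists (t / 2).
  by rewrite mulrC divfK.
have halves k : Gamma (transl ((u / 2 ^+ k) *: n)).
  elim: k => [|k IH]; first by rewrite expr0 divr1.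
  by rewrite exprSr invfM mulrA; exact: half.
have [e e0 He] := fdg_discrete HG.
have nn0 : n != 0 by rewrite -dot_eq0 n1 oner_eq0.
(* With this [k] one has [|u *: n| / e < k + 1 <= 2 ^ k], so the [k]-th half is shorter than [e]. *)
pose k := Num.truncn (`|u *: n| / e).
have : transl ((u / 2 ^+ k) *: n) = aff_id.
  apply: He => //=; first by rewrite subrr normr0.
  rewrite mulrC -scalerA normrZ normfV normrX [`|2|]ger0_norm// mulrC.
  rewrite ltr_pdivrMr ?exprn_gt0// -ltr_pdivrMl// mulrC.
  apply: lt_le_trans (truncnS_gt _) _; rewrite -natrX ler_nat.
  exact: ltn_expl.
case=> /eqP; rewrite scaler_eq0 (negPf nn0) orbF mulf_eq0 (negPf u0) invr_eq0.
by rewrite expf_eq0 pnatr_eq0 andbF.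
Qed.

Section Extension.
Context (s : R).
Let v := s *: n.
Context (G2v : Gamma (transl (2 *: v))) (nGv : ~ Gamma (transl v)).

Definition shift g w : @affine_map R m := (g.1, g.2 + w).

Lemma shift_comp g w : Gamma g -> Gamma (transl w) -> Gamma (shift g w).
Proof. by move=> Gg Gw; have := fdg_comp HG Gg Gw;
  rewrite /aff_comp /= !mulmx1. Qed.

Lemma shiftD g w w' : shift (shift g w) w' = shift g (w + w').
Proof. by rewrite /shift /= addrA. Qed.

Lemma shift0 g : shift g 0 = g.
Proof. by case: g => A b; rewrite /shift /= addr0. Qed.

(** The union of [Gamma] and its coset by the translation by [v]. *)
Definition half_extension : set (@affine_map R m) :=
  [set d | Gamma d \/ Gamma (shift d (- v))].

Local Notation Delta := half_extension.

Lemma double_v : v + v = 2 *: v. Proof. by rewrite scaler_nat mulr2n. Qed.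

Lemma shift_odd g : Gamma g -> ~ Gamma (shift g v) /\ ~ Gamma (shift g (- v)).
Proof.
move=> Gg.
have key w : Gamma (shift g w) -> Gamma (transl w).
  move=> Gw; have := fdg_comp HG (fdg_inv HG Gg) Gw.
  rewrite /aff_comp /shift /= (aff_isometryC (iso Gg)) mulNmx -mulmxA.
  by rewrite (aff_isometryC (iso Gg)) mulmx1 addKr.
split=> /key// /translN; rewrite opprK; exact: nGv.
Qed.

Lemma shift_flip g : Gamma (shift g v) <-> Gamma (shift g (- v)).
Proof.
split=> H.
  by have := shift_comp H (translN G2v);
    rewrite shiftD -double_v opprD addrA subrr add0r.
by have := shift_comp H G2v; rewrite shiftD -double_v addrA addNr add0r.
Qed.

Lemma half_extensionP d : Delta d ->
  exists g, Gamma g /\ (d = g \/ d = shift g v).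
Proof.
case=> [Gd|Gd]; first by exists d; split=> //; left.
exists (shift d (- v)); split=> //; right.
by rewrite shiftD addNr shift0.
Qed.

Lemma shift_half_extension g : Gamma g -> Delta (shift g v).
Proof. by move=> Gg; right; rewrite shiftD subrr shift0. Qed.

Lemma v_eigen g : Gamma g -> v *m g.1 = v \/ v *m g.1 = - v.
Proof.
move=> Gg; rewrite /v -scalemxAl.
by have [->|->] := bn_eigen Hn Gg; [left|right; rewrite scalerN].
Qed.

(** Since [v] is an eigenvector of [h.1] with eigenvalue 1 or -1, moving the shift past [h] at most
    changes its sign; two shifts then add up to [2 *: v] or cancel. *)
Lemma shift_mul g h : Gamma g -> Gamma h ->
  [/\ aff_comp g (shift h v) = shift (aff_comp g h) v,
      Gamma (shift (aff_comp (shift g v) h) v) &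
      Gamma (aff_comp (shift g v) (shift h v))].
Proof.
move=> Gg Gh; have Ggh := fdg_comp HG Gg Gh.
have E : aff_comp (shift g v) h = shift (aff_comp g h) (v *m h.1).
  by rewrite /aff_comp /shift /= mulmxDl addrAC.
have E2 : aff_comp (shift g v) (shift h v) = shift (aff_comp g h) (v *m h.1 +
  v).
  by rewrite -shiftD -E /aff_comp /shift /= addrA.
split; first by rewrite /aff_comp /shift /= addrA.
  rewrite E shiftD; have [->|->] := v_eigen Gh; last by rewrite addNr shift0.
  by rewrite double_v; exact: shift_comp.
rewrite E2; have [->|->] := v_eigen Gh; last by rewrite addNr shift0.
by rewrite double_v; exact: shift_comp.
Qed.

Lemma half_extension_index2 g h : Delta g -> Delta h ->
  Gamma (aff_comp g h) <-> (Gamma g <-> Gamma h).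
Proof.
move=> /half_extensionP[g' [Gg' gE]] /half_extensionP[h' [Gh' hE]].
have [M1 M2 M3] := shift_mul Gg' Gh'; have Ggh := fdg_comp HG Gg' Gh'.
have [ng _] := shift_odd Gg'; have [nh _] := shift_odd Gh'.
have [ngh _] := shift_odd Ggh.
case: gE => ->; case: hE => ->; split=> //.
- by rewrite M1 => /ngh.
- by case=> /(_ Gg') /nh.
- by move=> H; have [/(_ M2)] := shift_odd H.
- by case=> _ /(_ Gh') /ng.
Qed.

Lemma half_extension_comp g h : Delta g -> Delta h -> Delta (aff_comp g h).
Proof.
move=> /half_extensionP[g' [Gg' gE]] /half_extensionP[h' [Gh' hE]].
have [M1 M2 M3] := shift_mul Gg' Gh'; have Ggh := fdg_comp HG Gg' Gh'.
case: gE => ->; case: hE => ->; [by left| |by right; apply/shift_flip|by left].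
by rewrite M1; exact: shift_half_extension.
Qed.

(** If [g] flips [v], a fixed point [x] gives the fixed point [x - v / 2] of [g]. If [g] is a
    translation, it is the one by [-v], so [v] would give an element of [Gamma]. Otherwise [bn_axis]
    provides an axis along which every point moves. *)
Lemma shift_fixfree g x : Gamma g -> aff_act (shift g v) x <> x.
Proof.
move=> Gg; rewrite /aff_act /= addrA => gx.
have [vg|vg] := v_eigen Gg; last first.
  have gid : g = aff_id.
    apply: (fdg_free HG (x := x - 2^-1 *: v)) => //.
    rewrite /aff_act mulmxBl -scalemxAl vg scalerN opprK.
    rewrite -[in RHS]gx -!addrA; congr (_ + _); rewrite addrC; congr (_ + _).
    have vE : v = 2^-1 *: v + 2^-1 *: v by rewrite -scalerDl -[2^-1]div1r
      -splitr scale1r.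
    by rewrite {2}vE addrK.
  move: vg; rewrite gid /= mulmx1 => vN; apply: nGv.
  have /eqP : 2 *: v = 0 by rewrite -double_v {1}vN addNr.
  by rewrite scaler_eq0 pnatr_eq0 /= => /eqP ->; exact: fdg_id.
have [A1|A1] := eqVneq g.1 1%:M.
  move: gx; rewrite A1 mulmx1 -addrA => /(congr1 (fun y => y - x)).
  rewrite addrAC subrr add0r => /eqP; rewrite addr_eq0 => /eqP bv.
  have : Gamma (transl (- v)) by rewrite /transl -bv -A1; case: (g) Gg.
  by move=> /translN; rewrite opprK.
have [v0|v0] := eqVneq v 0; first by apply: nGv; rewrite v0; exact: fdg_id.
have ng : n *m g.1 = n.
  have [//|ng] := bn_eigen Hn Gg; exfalso; move: vg v0.
  rewrite /v -scalemxAl ng scalerN => /eqP;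
    rewrite eq_sym -addr_eq0 -mulr2n -scaler_nat.
  by rewrite scaler_eq0 pnatr_eq0 /= => ->.
have [e [eg ne be]] := bn_axis Hn Gg ng (elimN eqP A1).
have := congr1 (dot^~ e) gx.
rewrite !dotDl dot_mulmx isometry_fixT// [dot v e]dotZl ne mulr0 addr0.
by move=> /(canRL (addKr _)); rewrite addNr.
Qed.

Lemma half_extension_free_discrete : free_discrete_group Delta.
Proof.
split.
- by move=> d [/iso//|/iso].
- by left; exact: fdg_id.
- exact: half_extension_comp.
- move=> d /half_extensionP[g [Gg [->|->]]]; first by left; exact: fdg_inv.
  have Gi := fdg_inv HG Gg.
  have -> : aff_inv (shift g v) = shift (aff_inv g) (- (v *m g.1^T)).
    by rewrite /aff_inv /shift /= mulmxDl opprD.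
  have [E|E] := v_eigen Gi; rewrite /= in E; rewrite E ?opprK.
    by right; apply/shift_flip; rewrite shiftD addNr shift0.
  exact: shift_half_extension.
- have [e e0 He] := fdg_discrete HG.
  (* The translation part of an element of the new coset is [g 0 + v]. It never vanishes, so
     closedness of the orbit of 0 bounds it away from 0. *)
  have [|c c0 Hc] := @orbit_separated _ _ _ HG 0 (- v).
    move=> g Gg g0; apply: (shift_fixfree (g := g) (x := 0)) => //.
    by move: g0; rewrite /aff_act /= addrA => ->; rewrite addNr.
  exists (Num.min e c); first by rewrite lt_min e0.
  move=> d /half_extensionP[g [Gg [->|->]]];
    rewrite !lt_min => /andP[d1 _] /andP[d2 d3].
    exact: He.
  by have := Hc _ Gg; rewrite /aff_act mul0mx add0r opprK leNgt d3.
- move=> d x /half_extensionP[g [Gg [->|->]]]; first exact: (fdg_free HG).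
  by move=> /(shift_fixfree Gg).
Qed.

Lemma half_extension_boundary :
  geodesic_boundary_of_compact_flat (flat_quotient Gamma).
Proof.
apply: (@index2_geodesic_boundary R m Gamma Delta _ _ _ _ (transl v)) => //.
- exact: half_extension_free_discrete.
- by move=> g Gg; left.
- exact: fdg_id.
- exact: half_extension_index2.
- have := shift_half_extension (fdg_id HG).
  by rewrite /shift /= add0r.
Qed.

End Extension.

Lemma bounding_normal_boundary :
  geodesic_boundary_of_compact_flat (flat_quotient Gamma).
Proof.
have [s [G2s nGs]] := half_transl_exists.
by apply: (@half_extension_boundary s) => //; rewrite scalerA.
Qed.

End HalfTranslation.

(** * Orthogonal matrices near the identity in rank, and fixed points *)

Section Orthogonal.
Context {R : realType}.

(** The matrix determinant lemma, by a factorization into block-triangular matrices. *)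
Lemma det_1Dmul {m} (c : 'cV[R]_m) (r : 'rV[R]_m) :
  \det (1%:M + c *m r) = 1 + (r *m c) 0 0.
Proof.
have E : block_mx 1%:M 0 r 1%:M *m block_mx (1%:M + c *m r) c 0 (1%:M : 'M[R]_1)
    *m block_mx 1%:M 0 (- r) 1%:M = block_mx 1%:M c 0 (1%:M + r *m c).
  rewrite !mulmx_block !mulmx0 !mul0mx !mul1mx !mulmx1 !addr0 !add0r.
  rewrite mulmxN addrK; congr block_mx.
    by rewrite mulmxDr mulmx1 mulmxDl mul1mx !mulmxN mulmxA -opprD [X in -
      X]addrC subrr.
  by rewrite addrC.
have := congr1 determinant E.
rewrite !det_mulmx !det_lblock !det_ublock !det1 !mul1r !mulr1 => ->.
by rewrite det_mx11 !mxE eqxx.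
Qed.

Lemma det_reflection {m} (n : 'rV[R]_m) : dot n n = 1 -> \det (reflection n) =
  -1.
Proof.
move=> n1; rewrite /reflection -scalerN -mulNmx scalemxAl det_1Dmul.
rewrite -scalemxAr mulmxN mxE mxE -/(dot n n) n1; lra.
Qed.

Lemma reflection_inj_parallel {m} (n k : 'rV[R]_m) c :
  dot n n = 1 -> dot k k = 1 -> k = c *: n -> reflection k = reflection n.
Proof.
move=> n1 k1 kE; have c1 : c * c = 1 by move: k1;
  rewrite kE dotZl dotZr n1 mulr1.
have kT : k^T = c *: n^T by rewrite kE linearZ.
by rewrite /reflection kT kE -scalemxAl -scalemxAr (scalerA c c) c1 scale1r.
Qed.

Lemma reflection_comm_orth {m} (n k : 'rV[R]_m) : dot n k = 0 ->
  reflection n *m reflection k = reflection k *m reflection n.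
Proof.
move=> nk; apply/row_matrixP => i; rewrite !rowE !mulmxA.
rewrite !mul_reflection !dotDl !dotNl !dotZl nk (dotC k) nk !mulr0 !subr0.
by rewrite addrAC.
Qed.

(** Applied to [n], the two products differ by [4 c (k - c n)] with [c = dot n k]; so either [c = 0]
    or [k] is a multiple of [n]. *)
Lemma reflection_comm {m} (n k : 'rV[R]_m) : dot n n = 1 -> dot k k = 1 ->
  reflection n *m reflection k = reflection k *m reflection n ->
  dot n k = 0 \/ reflection n = reflection k.
Proof.
move=> n1 k1 /(congr1 (mulmx n)); rewrite !mulmxA (reflection_unit n1) mulNmx.
rewrite !mul_reflection dotDl dotNl dotZl n1 (dotC k n); set c := dot n k => E.
have [->|c0] := eqVneq c 0; [by left|right].
apply/esym/(reflection_inj_parallel n1 k1 (c := c)).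
apply: (scalerI (a := 4 * c)); first by rewrite mulf_neq0 ?pnatr_eq0.
rewrite scalerA; apply/eqP; rewrite -subr_eq0; apply/eqP.
have /eqP := E; rewrite -subr_eq0 => /eqP <-.
apply/rowP => j; rewrite !mxE; ring.
Qed.

Lemma submx_rank_eq {m1 m2 n} (A : 'M[R]_(m1, n)) (B : 'M[R]_(m2, n)) :
  (A <= B)%MS -> (\rank B <= \rank A)%N -> (B <= A)%MS.
Proof. by move=> sAB; rewrite (geq_leqif (mxrank_leqif_sup sAB)). Qed.

(** Write [A = 1 - D r] with [r] a row. Determinant 1 gives [r D = 0], hence [A^T = 1 + D r].
    Comparison with the transpose of [A] and multiplication by [r] give [dot r r *: D^T = 0]. *)
Lemma orthogonal_rank_le1 {m} (A : 'M[R]_m) : A *m A^T = 1%:M -> \det A = 1 ->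
  (\rank (1%:M - A)%R <= 1)%N -> A = 1%:M.
Proof.
move=> AA dA rA; apply: contrapT => A1.
have M0 : 1%:M - A != 0 by rewrite subr_eq0; apply/eqP => /esym.
have /row_subPn[i] : ~~ ((1%:M - A)%R <= (0 : 'M[R]_m))%MS by rewrite submx0.
rewrite submx0; set r := row i _ => r0.
have /submxP[D DE] : ((1%:M - A)%R <= r)%MS.
  by apply: submx_rank_eq; [exact: row_sub|rewrite rank_rV r0].
have AE : A = 1%:M + D *m (- r) by rewrite mulmxN -DE opprB addrC subrK.
have rD : - r *m D = 0.
  have := dA; rewrite AE det_1Dmul => /(canRL (addKr _)); rewrite addNr => rD0.
  by apply/matrixP => a b; rewrite !ord1 rD0 mxE.
have AT : A^T = 1%:M - D *m (- r).
  rewrite -[LHS]mulmx1 -[1%:M in LHS](_ : A *m (1%:M - D *m (- r)) = _).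
    by rewrite mulmxA (mulmx1C AA) mul1mx.
  rewrite {1}AE mulmxBr mulmx1 mulmxDl mul1mx -mulmxA (mulmxA (- r)) rD mul0mx
    mulmx0.
  by rewrite addr0 addrK.
have : - r *m (- r)^T *m D^T = 0.
  have : (- r)^T *m D^T = - (D *m (- r)).
    by apply: (addrI 1%:M); rewrite -AT AE linearD /= trmx1 trmx_mul.
  by rewrite -mulmxA => ->; rewrite mulmxN mulmxA rD mul0mx oppr0.
rewrite dot_mx mul_scalar_mx => /eqP;
  rewrite scaler_eq0 dot_eq0 oppr_eq0 (negPf r0) /=.
move=> /eqP D0; apply: A1; rewrite AE.
by rewrite -[D]trmxK D0 trmx0 mul0mx addr0.
Qed.

(** A fixed point solves [x (1 - A) = b]. The row space of [1 - A] lies in the orthogonal complement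
    of [e], and by the rank hypothesis fills it. *)
Lemma affine_fixpoint {m} (A : 'M[R]_m) (b e : 'rV[R]_m) :
  A *m A^T = 1%:M -> (m <= (\rank (1%:M - A)%R).+1)%N ->
  e != 0 -> e *m A = e -> dot b e = 0 -> exists x, aff_act (A, b) x = x.
Proof.
move=> AA rA e0 eA be.
have AeT : A *m e^T = e^T.
  by rewrite -[LHS]trmxK trmx_mul trmxK -{1}eA -mulmxA AA mulmx1.
have sub : ((1%:M - A)%R <= kermx e^T)%MS.
  by apply/sub_kermxP; rewrite mulmxBl mul1mx AeT subrr.
have /submxP[x xE] : (b <= (1%:M - A)%R)%MS.
  have bk : (b <= kermx e^T)%MS by apply/sub_kermxP;
    rewrite dot_mx be -scalemx1 scale0r.
  apply: (submx_trans bk); apply: (submx_rank_eq sub).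
  by rewrite mxrank_ker mxrank_tr rank_rV e0 leq_subLR add1n.
exists x; rewrite /aff_act /= xE mulmxBr mulmx1 addrC subrK //.
Qed.

End Orthogonal.

(** * Holonomy of free discrete groups in dimension three *)

Section DimensionThree.
Context {R : realType}.
Implicit Types (A : 'M[R]_3) (n k e u : 'rV[R]_3).

Lemma common_orthogonal n k : exists2 e, e != 0 & dot e n = 0 /\ dot e k = 0.
Proof.
have K0 : kermx (row_mx n^T k^T) != 0.
  rewrite -mxrank_eq0 mxrank_ker subn_eq0 -ltnNge ltnS.
  exact: (rank_leq_col (row_mx n^T k^T)).
have /rowV0Pn[e /sub_kermxP ek e0] := K0; exists e => //.
move: ek; rewrite mul_mx_row -[0]row_mx0 => /eq_row_mx[en ek].
by rewrite /dot en ek !mxE.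
Qed.

Lemma normalize_vector e : e != 0 -> exists2 c, c != 0 & dot (c *: e) (c *: e)
  = 1.
Proof.
rewrite -dot_eq0 => e0;
  have ep : 0 < dot e e by rewrite lt_neqAle eq_sym e0 dot_ge0.
exists (Num.sqrt (dot e e))^-1; first by rewrite invr_eq0 gt_eqF// sqrtr_gt0.
by rewrite dotZl dotZr mulrA -invfM -expr2 sqr_sqrtr ?dot_ge0// mulVf.
Qed.

(** [A] has an eigenvector [n] for -1 and an orthogonal eigenvector [u] for 1. Composing with the
    reflection along [n] gives determinant 1 and fixes both, so in dimension 3 it differs from the
    identity by rank at most 1. *)
Lemma orthogonal_reflection A : A *m A^T = 1%:M -> \det A = -1 ->
  \det (1%:M - A) = 0 -> exists2 n, dot n n = 1 & A = reflection n.
Proof.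
move=> AA dA d1.
have /eqP/det0P[n' n'0 n'A] : \det (1%:M + A) = 0.
  have E : A *m (1%:M + A)^T = 1%:M + A.
    by rewrite linearD /= trmx1 mulmxDr mulmx1 AA addrC.
  have := congr1 determinant E; rewrite det_mulmx det_tr dA; lra.
have [c c0 n1] := normalize_vector n'0; set n := c *: n' in n1.
have nA : n *m A = - n.
  apply/eqP; rewrite -addr_eq0 addrC -[X in X + _]mulmx1 -mulmxDr.
  by rewrite /n -scalemxAl n'A scaler0.
have /eqP/det0P[u u0 uA'] := d1.
have uA : u *m A = u.
  by apply/esym/eqP; rewrite -subr_eq0 -[X in X - _]mulmx1 -mulmxBr uA'.
have nAT : n *m A^T = - n.
  by rewrite -[LHS]opprK -mulNmx -nA -mulmxA AA mulmx1.
have un : dot u n = 0.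
  by have := dot_mulmx u n A; rewrite uA nAT dotNr; lra.
exists n => //.
pose B := A *m reflection n.
suff B1 : B = 1%:M.
  by rewrite -[LHS]mulmx1 -(reflectionK n1) mulmxA -/B B1 mul1mx.
have BB : B *m B^T = 1%:M.
  by rewrite trmx_mul tr_reflection mulmxA -(mulmxA A) reflectionK// mulmx1.
have dB : \det B = 1 by rewrite det_mulmx dA det_reflection// mulrNN mulr1.
have uB : u *m (1%:M - B) = 0.
  by rewrite mulmxBr mulmx1 mulmxA uA reflection_orth// subrr.
have nB : n *m (1%:M - B) = 0.
  by rewrite mulmxBr mulmx1 mulmxA nA mulNmx reflection_unit// opprK subrr.
apply: orthogonal_rank_le1 => //; rewrite leqNgt; apply/negP => r2.
have n0 : n != 0 by rewrite -dot_eq0 n1 oner_eq0.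
have nK : (n <= kermx (1%:M - B)%R)%MS by apply/sub_kermxP.
have uK : (u <= kermx (1%:M - B)%R)%MS by apply/sub_kermxP.
have Kn : (kermx (1%:M - B)%R <= n)%MS.
  apply: (submx_rank_eq nK); rewrite mxrank_ker rank_rV n0 leq_subLR.
  by rewrite addn1 ltnS.
have /sub_rVP[a uE] := submx_trans uK Kn.
by move: un u0; rewrite uE dotZl n1 mulr1 => ->; rewrite scale0r eqxx.
Qed.

Context (Gamma : set (@affine_map R 3)) (HG : free_discrete_group Gamma).
Let iso := fdg_isometry HG.

Lemma det_sign g : Gamma g -> \det g.1 = 1 \/ \det g.1 = -1.
Proof.
move=> Gg; have /(congr1 determinant) := iso Gg.
rewrite det_mulmx det_tr det1 -expr2 => /eqP; rewrite sqrf_eq1.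
by move=> /orP[/eqP|/eqP]; [left|right].
Qed.

(** If 1 were not an eigenvalue, [1 - g.1] would be invertible and [g] would have a fixed point. *)
Lemma holonomy_reflection g : Gamma g -> \det g.1 = -1 ->
  exists2 n, dot n n = 1 & g.1 = reflection n.
Proof.
move=> Gg dg; apply: orthogonal_reflection => //; first exact: iso.
apply/eqP; apply: contrapT => /negP d0.
have un : 1%:M - g.1 \in unitmx by rewrite unitmxE unitfE.
have : g = aff_id.
  apply: (fdg_free HG (x := g.2 *m invmx (1%:M - g.1))) => //.
  rewrite /aff_act; set x := g.2 *m _.
  have -> : g.2 = x *m (1%:M - g.1) by rewrite /x mulmxKV.
  by rewrite mulmxBr mulmx1 addrC subrK.
by move=> gid; move: dg; rewrite gid det1; lra.
Qed.

(** A linear part other than the identity makes [1 - g.1] of rank at least 2, and [affine_fixpoint]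
    contradicts freeness. *)
Lemma no_pure_rotation g e : Gamma g -> \det g.1 = 1 -> e != 0 ->
  e *m g.1 = e -> dot g.2 e = 0 -> g.1 = 1%:M.
Proof.
move=> Gg dg e0 eg ge; apply: contrapT => g1.
have [|x gx] := @affine_fixpoint _ _ g.1 g.2 e (iso Gg) _ e0 eg ge.
  rewrite ltnS ltnNge; apply/negP => r1; apply: g1.
  exact: orthogonal_rank_le1 (iso Gg) dg r1.
by apply: g1; rewrite (fdg_free HG (x := x) Gg) //; case: (g) gx.
Qed.

Lemma dot_comp g h e : is_affine_isometry h -> e *m h.1 = e ->
  dot (aff_comp g h).2 e = dot g.2 e + dot h.2 e.
Proof.
move=> hi he; rewrite dotDl dot_mulmx; congr (dot _ _ + _).
by rewrite -{1}he -mulmxA hi mulmx1.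
Qed.

Lemma fix_inv g e : is_affine_isometry g -> e *m g.1 = e -> e *m (aff_inv g).1
  = e.
Proof. by move=> gi {1}<-; rewrite -mulmxA gi mulmx1. Qed.

Lemma dot_inv g e : is_affine_isometry g -> e *m g.1 = e ->
  dot (aff_inv g).2 e = - dot g.2 e.
Proof.
move=> gi ge; have gi' : is_affine_isometry (aff_inv g).
  by rewrite /is_affine_isometry /= trmxK aff_isometryC.
have := dot_comp g gi' (fix_inv gi ge).
rewrite aff_compV// [X in X = _](_ : _ = 0); last by rewrite /dot mul0mx mxE.
by move=> /esym/eqP; rewrite addrC addr_eq0 => /eqP.
Qed.

Lemma holonomy_reflections g h n k : Gamma g -> Gamma h ->
  dot n n = 1 -> dot k k = 1 -> g.1 = reflection n -> h.1 = reflection k ->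
  dot n k = 0 \/ reflection n = reflection k.
Proof.
move=> Gg Gh n1 k1 gE hE; apply: reflection_comm => //; rewrite -gE -hE.
have [e e0 [en ek]] := common_orthogonal n k.
have eg : e *m g.1 = e by rewrite gE reflection_orth.
have eh : e *m h.1 = e by rewrite hE reflection_orth.
have Gg' := fdg_inv HG Gg; have Gh' := fdg_inv HG Gh.
have eg' := fix_inv (iso Gg) eg; have eh' := fix_inv (iso Gh) eh.
(* Translation components along the common fixed vector [e] add up under composition, so those of
   the commutator cancel. *)
have := @no_pure_rotation (aff_comp (aff_comp g h) (aff_comp (aff_inv g)
  (aff_inv h))) e.
have Ggh := fdg_comp HG Gg Gh; have Ggh' := fdg_comp HG Gg' Gh'.
move=> H; have {H} : g.1 *m h.1 *m (g.1^T *m h.1^T) = 1%:M.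
  apply: H => //; first exact: fdg_comp.
  - rewrite /= !det_mulmx !det_tr gE hE !det_reflection//; lra.
  - by rewrite /= !mulmxA eg eh (eg' : _ *m g.1^T = _) (eh' : _ *m h.1^T = _).
  - have egh' : e *m (aff_comp (aff_inv g) (aff_inv h)).1 = e.
      by rewrite /= mulmxA (eg' : _ *m g.1^T = _).
    rewrite (dot_comp _ (iso Ggh') egh') (dot_comp _ (iso Gh) eh).
    by rewrite (dot_comp _ (iso Gh') eh') (dot_inv (iso Gg) eg) (dot_inv (iso
      Gh) eh); lra.
move=> /(congr1 (mulmx^~ (h.1 *m g.1))); rewrite mul1mx => <-.
rewrite -!mulmxA (mulmxA h.1^T) (aff_isometryC (iso Gh)) mul1mx.
by rewrite (aff_isometryC (iso Gg)) mulmx1.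
Qed.

(* The product of the three elements has linear part [-1], which has determinant
   -1 without being a reflection. *)
Lemma holonomy_no_frame g h l n k p : Gamma g -> Gamma h -> Gamma l ->
  dot n n = 1 -> dot k k = 1 -> dot p p = 1 ->
  g.1 = reflection n -> h.1 = reflection k -> l.1 = reflection p ->
  dot n k = 0 -> dot n p = 0 -> dot k p = 0 -> False.
Proof.
move=> Gg Gh Gl n1 k1 p1 gE hE lE nk np kp.
have Gghl := fdg_comp HG (fdg_comp HG Gg Gh) Gl.
have [|q q1 qE] := holonomy_reflection Gghl.
  by rewrite /= !det_mulmx gE hE lE !det_reflection//; lra.
(* A vector negated by the reflection is a multiple of [q]; both [n] and [k] are negated, although
   they are orthogonal. *)
have flipped v : v *m reflection q = - v -> v = dot v q *: q.
  move=> E; apply: (scalerI (a := 2)); first by rewrite pnatr_eq0.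
  apply/eqP; rewrite scalerA -subr_eq0 scaler_nat mulr2n addrAC.
  by rewrite -mul_reflection E addNr.
have nE : n = dot n q *: q.
  apply: flipped; rewrite -qE /= !mulmxA gE hE lE reflection_unit// !mulNmx.
  by rewrite !reflection_orth.
have kE : k = dot k q *: q.
  have kn : dot k n = 0 by rewrite dotC.
  apply: flipped; rewrite -qE /= !mulmxA gE hE lE (reflection_orth kn).
  by rewrite (reflection_unit k1) mulNmx (reflection_orth kp).
move: nk n1 k1; rewrite nE kE !dotZl !dotZr q1.
move: (dot n q) (dot k q) => a b; rewrite !mulr1 => /eqP; rewrite mulf_eq0.
by move=> /orP[]/eqP->; rewrite ?mul0r => *; lra.
Qed.

End DimensionThree.

(** * Choice of the normal along which the group is extended *)

Section BoundingNormal.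
Context {R : realType} (Gamma : set (@affine_map R 3)).
Context (HG : free_discrete_group Gamma).
Implicit Types (g h : @affine_map R 3) (n k e : 'rV[R]_3).

Lemma unit_neqN n : dot n n = 1 -> n <> - n.
Proof. by move=> n1 nN; have := n1; rewrite {1}nN dotNl n1; lra. Qed.

Lemma bounding_normal_single g0 n : Gamma g0 -> g0.1 = reflection n -> dot n n
  = 1 ->
  (forall g, Gamma g -> g.1 = 1%:M \/ g.1 = reflection n) -> bounding_normal
    Gamma n.
Proof.
move=> Gg0 g0E n1 H; split=> //.
- by exists g0.
- move=> g /H[]->; first by left; rewrite mulmx1.
  by right; rewrite reflection_unit.
- by move=> g /H[]-> _; rewrite ?mulmx1 ?reflectionK.
- move=> g /H[]-> //; rewrite reflection_unit// => /esym nN.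
  by have := unit_neqN n1 nN.
Qed.

(** The elements fixing [n] have linear part the identity or the reflection along [k]; for the
    latter [e] is the axis demanded by [bn_axis]. *)
Lemma bounding_normal_pair g0 n k e : Gamma g0 -> g0.1 = reflection n ->
  dot n n = 1 -> dot k k = 1 -> dot n k = 0 -> dot e n = 0 -> dot e k = 0 ->
  (forall g, Gamma g -> [\/ g.1 = 1%:M, g.1 = reflection n, g.1 = reflection k |
    g.1 = reflection n *m reflection k]) ->
  (forall h, Gamma h -> h.1 = reflection k -> dot h.2 e <> 0) ->
  bounding_normal Gamma n.
Proof.
move=> Gg0 g0E n1 k1 nk en ek H He.
have nn : n *m reflection n = - n by exact: reflection_unit.
have nkn : n *m (reflection n *m reflection k) = - n.
  by rewrite mulmxA nn mulNmx reflection_orth.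
have nN := unit_neqN n1.
split=> //.
- by exists g0.
- move=> g /H[]->; rewrite ?mulmx1 ?nn ?nkn ?reflection_orth//; by [left|right].
- move=> g /H[]->; rewrite ?nn ?nkn ?mulmx1 ?reflectionK// => /esym //.
- move=> g Gg; have := H g Gg; case=> E; rewrite E ?nn ?nkn // => /esym // _ _.
  exists e; split; first by rewrite reflection_orth.
    by rewrite dotC.
  exact: He.
Qed.

Lemma bounding_normal_exists g0 : Gamma g0 -> \det g0.1 = -1 ->
  exists n, bounding_normal Gamma n.
Proof.
move=> Gg0 dg0; have [n n1 g0E] := holonomy_reflection HG Gg0 dg0.
have detn : \det (reflection n) = -1 by exact: det_reflection.
(* Composition with [g0] turns determinant 1 into -1, so all linear parts are found from the
   reflections. *)
have pos g : Gamma g -> \det g.1 = 1 -> Gamma (aff_comp g g0) /\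
    \det (g.1 *m reflection n) = -1.
  by move=> Gg dg; split;
    [exact: (fdg_comp HG)|rewrite det_mulmx dg detn mul1r].
have cancel A B : A *m reflection n = B -> A = B *m reflection n.
  by move=> <-; rewrite -mulmxA reflectionK// mulmx1.
have [[h [k [Gh k1 nk hE]]]|none] := pselect (exists h k,
  [/\ Gamma h, dot k k = 1, dot n k = 0 & h.1 = reflection k]); last first.
  have neg g : Gamma g -> \det g.1 = -1 -> g.1 = reflection n.
    move=> Gg dg; have [k k1 gE] := holonomy_reflection HG Gg dg.
    have [nk|->//] := holonomy_reflections HG Gg0 Gg n1 k1 g0E gE.
    by exfalso; apply: none; exists g, k.
  exists n; apply: (bounding_normal_single Gg0 g0E n1) => g Gg.
  have [dg|dg] := det_sign HG Gg; [left|right]; last exact: neg.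
  have [Gg' dg'] := pos _ Gg dg.
  have := neg _ Gg'; rewrite /= g0E => /(_ dg')/cancel ->.
  exact: reflectionK.
have neg g : Gamma g -> \det g.1 = -1 -> g.1 = reflection n \/ g.1 = reflection
  k.
  move=> Gg dg; have [p p1 gE] := holonomy_reflection HG Gg dg.
  have [np|->] := holonomy_reflections HG Gg0 Gg n1 p1 g0E gE; last by left.
  have [kp|->] := holonomy_reflections HG Gh Gg k1 p1 hE gE; last by right.
  by have := holonomy_no_frame HG Gg0 Gh Gg n1 k1 p1 g0E hE gE nk np kp.
have comm := reflection_comm_orth nk.
have hol g : Gamma g -> [\/ g.1 = 1%:M, g.1 = reflection n, g.1 = reflection k |
    g.1 = reflection n *m reflection k].
  move=> Gg; have [dg|/(neg _ Gg)[]->] := det_sign HG Gg; last 2 first.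
  - by constructor 2.
  - by constructor 3.
  have [Gg' dg'] := pos _ Gg dg.
  have := neg _ Gg'; rewrite /= g0E => /(_ dg')[]/cancel ->.
    by constructor 1; exact: reflectionK.
  by constructor 4.
have [e e0 [en ek]] := common_orthogonal n k.
have [Hk|] := pselect (forall g, Gamma g -> g.1 = reflection k -> dot g.2 e <>
  0).
  by exists n; exact: (bounding_normal_pair Gg0 g0E n1 k1 nk en ek hol Hk).
(* Now [h1] does not translate along [e], and [n] and [k] exchange roles: if some [g1] over the
   reflection along [n] did not either, its product with [h1] would be a non-trivial rotation
   without translation along its axis. *)
move=> /existsNP[h1 /not_implyP[Gh1 /not_implyP[h1E /contrapT h1e]]].
exists k; apply: (bounding_normal_pair Gh hE k1 n1 _ ek en);
  first by rewrite dotC.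
  move=> g /hol[]->; [by constructor 1|by constructor 3|by constructor 2|].
  by constructor 4.
move=> g1 Gg1 g1E g1e.
have eh : e *m h1.1 = e by rewrite h1E reflection_orth.
have eg : e *m g1.1 = e by rewrite g1E reflection_orth.
have := @no_pure_rotation _ _ HG (aff_comp g1 h1) e.
have E : g1.1 *m h1.1 = 1%:M -> False.
  move=> /(congr1 (mulmx n)); rewrite g1E h1E mulmx1 mulmxA reflection_unit//.
  by rewrite mulNmx reflection_orth// => /esym; exact: unit_neqN.
move=> H; apply: E; apply: H => //.
- exact: (fdg_comp HG).
- by rewrite /= det_mulmx g1E h1E !det_reflection// mulrNN mulr1.
- by rewrite /= mulmxA eg eh.
- by rewrite (dot_comp _ (fdg_isometry HG Gh1) eh) g1e h1e addr0.
Qed.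

End BoundingNormal.

Theorem proposition3p3 (R : realType) (Gamma : set ('M[R]_3 * 'rV[R]_3))
    (hGamma : bieberbach_group Gamma)
    (hN : ~ orientable (flat_quotient Gamma)) :
  geodesic_boundary_of_compact_flat (flat_quotient Gamma).
Proof.
have HG := bieberbach_free_discrete hGamma.
have [g Gg dg] := nonorientable_det HG hN.
have [n Hn] := bounding_normal_exists HG Gg dg.
exact: (bounding_normal_boundary HG (bieb_cocompact hGamma) Hn).
Qed.
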